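(* Let $d\in\{2,3\}$ and let $\Omega\subset\mathbb{R}^d$ be a bounded Lipschitz domain which is homeomorphic to a ball. Let $0\le\chi\in L^\infty(\Omega)$, and let $U:\Omega\times\mathbb{R}^d\to(-\infty,\infty]$ be measurable and such that for almost all $x\in\Omega$ the function $U(x,\cdot)$ is proper, closed, $\sigma$-strongly convex and two times continuously differentiable on its domain, with $\sigma>0$ independent of $x$. Let $\mathbf{j_s}=\operatorname{curl}\mathbf{H_s}$ for some $\mathbf{H_s}\in H(\operatorname{curl};\Omega)$. Let $\mathcal{T}_h$ be a geometrically conforming simplicial partition of $\Omega$, and assume that $\chi$, $U$, and $\mathbf{H_s}$ are piecewise continuous functions in space with respect to $\mathcal{T}_h$. Let $\psi_h\in V_h$ be the unique solution of $$(\nabla_{\mathbf{H}}w^*(\mathbf{H_s}-\nabla\psi_h),\nabla v_h)_h=0\qquad\forall v_h\in V_h.$$ Then for any $\psi_h^0\in V_h$, the iterates $\psi_h^n$ of the semi-smooth Newton method with Armijo backtracking (defined in the context) satisfy $$\|\psi_h^n-\psi_h\|_h\le C\,q^n\,\|\psi_h^0-\psi_h\|_h,\qquad n\ge1,$$ with constants $C\ge0$ and $q<1$ independent of $\mathcal{T}_h$; hence the iterative method exhibits global $r$-linear and mesh-independent convergence. For $\psi_h^n$ sufficiently close to $\psi_h$, Armijo backtracking returns $\tau^n=1$ and $$\|\psi_h^{n+1}-\psi_h\|_h=o(\|\psi_h^n-\psi_h\|_h)\quad\text{with }n\to\infty,$$ i.e., the method converges locally superlinearly.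
   Context: Data and discretization. $\mathbf{j_s}$ is the current density, $\mathbf{H_s}$ a source field, $\mu_0>0$ the permeability of vacuum, and $\mathbf{J}_p$ (with values in $\mathbb{R}^d$, depending on $x\in\Omega$) the given previous state of the magnetic polarization. The co-energy density is $$w^*(x,\mathbf{H})=\frac{\mu_0}{2}|\mathbf{H}|^2-\inf_{\mathbf{J}\in\mathbb{R}^d}\{U(x,\mathbf{J})-\langle\mathbf{H},\mathbf{J}\rangle+\chi(x)|\mathbf{J}-\mathbf{J}_p(x)|\};$$ the minimizer is denoted by $\mathbf{J}(\mathbf{H})$, and $\mathbf{B}(\mathbf{H})=\nabla_{\mathbf{H}}w^*(\mathbf{H})=\mu_0\mathbf{H}+\mathbf{J}(\mathbf{H})$, where the dependence on $x$ is suppressed. $V_h=\{v_h\in H^1(\Omega):\int_\Omega v_h\,dx=0,\ v_h|_T\in P_1(T)\ \forall T\in\mathcal{T}_h\}$; $(\mathbf{u}_h,\mathbf{v}_h)_h=\sum_{T\in\mathcal{T}_h}\mathbf{u}_h(x_T)\cdot\mathbf{v}_h(x_T)\,|T|$ with $x_T$ and $|T|$ the barycenter and the area (volume) of $T$; and $\|\mathbf{u}_h\|_h=\sqrt{(\mathbf{u}_h,\mathbf{u}_h)_h}$. Method. Starting from $\psi_h^0\in V_h$, update $\psi_h^{n+1}=\psi_h^n+\tau^n\delta\psi_h^n$, $n\ge0$, where the search direction $\delta\psi_h^n\in V_h$ is the solution of the linear system $$(\mathbb{S}_{\mathbf{B}}^n\nabla\delta\psi_h^n,\nabla v_h)_h=(\nabla_{\mathbf{H}}w^*(\mathbf{H_s}-\nabla\psi_h^n),\nabla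 v_h)_h\qquad\forall v_h\in V_h.$$ On every element $T\in\mathcal{T}_h$, $\mathbb{S}_{\mathbf{B}}^n|_T$ is chosen as the following element of Clarke's generalized Jacobian $\partial_{\mathbf{H}}\mathbf{B}(\mathbf{H})$ (the convex hull of all limits of Jacobian matrices of $\mathbf{B}$ at points of differentiability converging to $\mathbf{H}$) at $\mathbf{H}=\mathbf{H_s}(x_T)-\nabla\psi_h^n(x_T)$, with $\mathbf{J}=\mathbf{J}(\mathbf{H})$ and $\chi$, $U$, $\mathbf{J}_p$ taken at $x_T$: $$\mathbb{S}_{\mathbf{B}}=\begin{cases}\mu_0I,&\text{if }\mathbf{J}=\mathbf{J}_p,\\ \mu_0I+\Big(\nabla^2_{\mathbf{J}\mathbf{J}}U(\mathbf{J})+\frac{\chi}{|\mathbf{J}-\mathbf{J}_p|}\Big(I-\frac{(\mathbf{J}-\mathbf{J}_p)\otimes(\mathbf{J}-\mathbf{J}_p)}{|\mathbf{J}-\mathbf{J}_p|^2}\Big)\Big)^{-1},&\text{if }\mathbf{J}\neq\mathbf{J}_p,\end{cases}$$ where $I$ is the identity matrix and $a\otimes b=ab^\top$. The step size is determined by Armijo backtracking, $$\tau^n=\max\{\tau=\rho^m:\ \Phi(\tau)\le\Phi(0)+\sigma_A\,\tau\,\Phi'(0),\ m\ge0\},\qquad\Phi(\tau)=(w^*(\mathbf{H_s}-\nabla(\psi_h^n+\tau\,\delta\psi_h^n)),1)_h,$$ with given $0<\sigma_A<1/2$ and $\rho<1$. Terminology. A function $f:\mathbb{R}^d\to(-\infty,\infty]$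 is closed if its epigraph is closed; its domain is $\{f<\infty\}$; it is proper if its domain is nonempty; it is $\sigma$-strongly convex if $f-\frac{\sigma}{2}|\cdot|^2$ is convex. $H(\operatorname{curl};\Omega)$ is the space of fields in $L^2(\Omega)^d$ whose weak curl is square integrable.
   Formalization: The norm of potentials, defined only for fields, is read as the h-norm of the gradient (for the values at barycenters the estimate fails); U(x,·) is also assumed regular at the barycenters x_T, where the method evaluates it, with open domain; and ρ>0. *)

(* Defs.v *)
From HB Require Import structures.
From mathcomp Require Import all_boot all_order all_algebra.
From mathcomp Require Import all_classical all_reals all_analysis.
From mathcomp Require Import measurable_realfun.

Set Implicit Arguments.
Unset Strict Implicit.
Unset Printing Implicit Defensive.

Import Order.TTheory GRing.Theory Num.Theory.
Import numFieldNormedType.Exports.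

Local Open Scope classical_set_scope.
Local Open Scope ring_scope.

Definition measure_row_display : measure_display -> measure_display.
Proof. exact. Qed.

(* The sigma-algebra generated by the coordinates, i.e. the Borel sets. *)
Section measurable_row.
Variables (R : realType) (n : nat).

Let coord : 'I_n -> 'rV[R]_n -> R := fun i x => x ord0 i.

Let row_set0 : g_sigma_preimage coord set0.
Proof. exact: sigma_algebra0. Qed.

Let row_setC A : g_sigma_preimage coord A -> g_sigma_preimage coord (~` A).
Proof. exact: sigma_algebraC. Qed.

Let row_bigcup (F : _^nat) : (forall i, g_sigma_preimage coord (F i)) ->
  g_sigma_preimage coord (\bigcup_i (F i)).
Proof. exact: sigma_algebra_bigcup. Qed.

HB.instance Definition _ := @isMeasurable.Build
  (measure_row_display default_measure_display)
  'rV[R]_n (g_sigma_preimage coord) row_set0 row_setC row_bigcup.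

End measurable_row.

Section measurable_row_theory.
Variables (R : realType).

Lemma measurable_coord n (i : 'I_n) :
  measurable_fun [set: 'rV[R]_n] (fun x : 'rV[R]_n => x ord0 i).
Proof.
move=> _ Y mY; rewrite setTI; apply: sub_sigma_algebra => /=.
rewrite -bigcup_seq/=; exists i => /=; first by rewrite mem_index_enum.
by exists Y => //; rewrite setTI.
Qed.

Lemma measurable_fun_row d (T : measurableType d) n (f : T -> 'rV[R]_n) :
  (forall i, measurable_fun [set: T] (fun x => f x ord0 i)) ->
  measurable_fun [set: T] f.
Proof.
move=> mf _ A mA.
suff : g_sigma_preimage (fun i x => f x ord0 i) `<=` @measurable _ T.
  apply; rewrite (_ : (fun i x => f x ord0 i) =
    (fun i => (fun x : 'rV[R]_n => x ord0 i) \o f))//.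
  by rewrite g_sigma_preimage_comp/=; exists A.
apply: smallest_sub; first exact: sigma_algebra_measurable.
case: n => [|n] in f mf A mA *; first by rewrite big_ord0.
rewrite -bigcup_mkord_ord; apply: bigcup_sub => i Ii.
by move=> B [C mC <-]; exact: mf.
Qed.

Definition cons_row n (p : R * 'rV[R]_n) : 'rV[R]_n.+1 :=
  \row_i (if unlift ord0 i is Some j then p.2 ord0 j else p.1).

Definition uncons_row n (x : 'rV[R]_n.+1) : R * 'rV[R]_n :=
  (x ord0 ord0, \row_i x ord0 (lift ord0 i)).

Lemma cons_row0 n (p : R * 'rV[R]_n) : cons_row p ord0 ord0 = p.1.
Proof. by rewrite mxE unlift_none. Qed.

Lemma cons_rowS n (p : R * 'rV[R]_n) i :
  cons_row p ord0 (lift ord0 i) = p.2 ord0 i.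
Proof. by rewrite mxE liftK. Qed.

Lemma cons_rowK n : cancel (@cons_row n) (@uncons_row n).
Proof.
move=> [a v]; rewrite /uncons_row cons_row0; congr pair.
by apply/rowP => i; rewrite mxE cons_rowS.
Qed.

Lemma uncons_rowK n : cancel (@uncons_row n) (@cons_row n).
Proof.
move=> x; apply/rowP => i; case: (unliftP ord0 i) => [j|] ->.
  by rewrite cons_rowS mxE.
by rewrite cons_row0.
Qed.

Lemma measurable_cons_row n : measurable_fun setT (@cons_row n).
Proof.
apply: measurable_fun_row => i; case: (unliftP ord0 i) => [j|] ->.
  rewrite [X in measurable_fun _ X](_ : _ =
    (fun x : 'rV[R]_n => x ord0 j) \o snd).
    by apply: measurableT_comp; [exact: measurable_coord|exact: measurable_snd].
  by apply/funext => p; rewrite cons_rowS.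
rewrite [X in measurable_fun _ X](_ : _ = fst); first exact: measurable_fst.
by apply/funext => p; rewrite cons_row0.
Qed.

Lemma measurable_uncons_row n : measurable_fun setT (@uncons_row n).
Proof.
apply: measurable_fun_pair; first exact: measurable_coord.
apply: measurable_fun_row => i.
rewrite [X in measurable_fun _ X](_ : _ =
  (fun x : 'rV[R]_n.+1 => x ord0 (lift ord0 i))); first exact: measurable_coord.
by apply/funext => x; rewrite mxE.
Qed.

End measurable_row_theory.

Section lebesgue_row_succ.
Variables (R : realType) (n : nat).
Variable mu : {sigma_finite_measure set 'rV[R]_n -> \bar R}.

Definition lebesgue_rowS : set 'rV[R]_n.+1 -> \bar R :=
  pushforward (@lebesgue_measure R \x mu)%E (@cons_row R n).

Let preimage_measurable A : measurable A -> measurable (@cons_row R n @^-1` A).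
Proof. by move=> mA; rewrite -[X in measurable X]setTI; exact: measurable_cons_row. Qed.

Let lebesgue_rowS0 : lebesgue_rowS set0 = 0%E.
Proof. by rewrite /lebesgue_rowS /pushforward preimage_set0 measure0. Qed.

Let lebesgue_rowS_ge0 A : (0 <= lebesgue_rowS A)%E.
Proof. by rewrite /lebesgue_rowS /pushforward; apply: measure_ge0. Qed.

Let lebesgue_rowS_sigma_additive : semi_sigma_additive lebesgue_rowS.
Proof.
move=> F mF tF mUF; rewrite /lebesgue_rowS /pushforward preimage_bigcup.
apply: measure_semi_sigma_additive.
- by move=> k; exact: preimage_measurable.
- apply/trivIsetP => /= i j _ _ ij; rewrite -preimage_setI.
  by move/trivIsetP : tF => /(_ _ _ _ _ ij) ->//; rewrite preimage_set0.
- by rewrite -preimage_bigcup; exact: preimage_measurable.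
Qed.

HB.instance Definition _ := isMeasure.Build _ _ _ lebesgue_rowS
  lebesgue_rowS0 lebesgue_rowS_ge0 lebesgue_rowS_sigma_additive.

Let lebesgue_rowS_sigma_finite : sigma_finite setT lebesgue_rowS.
Proof.
have /sigma_finiteP[F [FT ndF Foo]] := sigma_finiteT (@lebesgue_measure R).
have /sigma_finiteP[G [GT ndG Goo]] := sigma_finiteT mu.
have FG : \bigcup_k (F k `*` G k) = setT.
  rewrite -setXTT FT GT predeqE => -[x y]; split.
    by move=> [k _ [? ?]]; split; exists k.
  move=> [/= [k _ Fkx] [l _ Gly]]; exists (maxn k l) => //; split.
  - by move: x Fkx; exact/subsetPset/ndF/leq_maxl.
  - by move: y Gly; exact/subsetPset/ndG/leq_maxr.
exists (fun k => @uncons_row R n @^-1` (F k `*` G k)).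
  by rewrite -preimage_bigcup FG.
move=> k; have [mF Fk] := Foo k; have [mG Gk] := Goo k; split.
  rewrite -[X in measurable X]setTI.
  by apply: measurable_uncons_row => //; exact: measurableX.
rewrite /lebesgue_rowS /pushforward -comp_preimage.
rewrite (_ : _ \o _ = id) ?preimage_id; last first.
  by apply/funext => p; exact: cons_rowK.
by rewrite product_measure1E// lte_mul_pinfty// ge0_fin_numE.
Qed.

HB.instance Definition _ := Measure_isSigmaFinite.Build _ _ _ lebesgue_rowS
  lebesgue_rowS_sigma_finite.

End lebesgue_row_succ.

(* On 'rV_0 the unit mass at the only point; on 'rV_(n.+1) the product of the
   Lebesgue measures on R and on 'rV_n. *)
Fixpoint lebesgue_row (R : realType) (n : nat) :
    {sigma_finite_measure set 'rV[R]_n -> \bar R} :=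
  if n is n'.+1 then lebesgue_rowS (lebesgue_row R n')
  else @dirac _ _ (0 : 'rV[R]_0) R.

Section euclidean.
Variables (R : realType) (d : nat).
Implicit Types (x y u v : 'rV[R]_d) (f : 'rV[R]_d -> R) (D : set 'rV[R]_d).

Definition dot u v : R := \sum_(i < d) u ord0 i * v ord0 i.

(* The library norm `|u| on 'rV[R]_d is the maximum norm. *)
Definition enorm u : R := Num.sqrt (dot u u).

Definition basis_row (i : 'I_d) : 'rV[R]_d := delta_mx ord0 i.

Definition partial (i : 'I_d) f : 'rV[R]_d -> R := 'D_(basis_row i) f.

Definition grad f x : 'rV[R]_d := \row_i partial i f x.

Definition hess f x : 'M[R]_d := \matrix_(i, j) partial j (partial i f) x.

Definition C2_on D f : Prop := forall x, D x ->
  [/\ differentiable f x, differentiable (grad f) x &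
      {for x, continuous (hess f)}].

Definition smooth f : Prop :=
  forall (s : seq 'I_d) x, differentiable (foldr partial f s) x.

Definition test_function D f : Prop :=
  smooth f /\
  exists K : set 'rV[R]_d,
    [/\ compact K, K `<=` D & forall x, ~ K x -> f x = 0].

End euclidean.

Section domains.
Variables (R : realType) (d : nat).
Implicit Types Omega : set 'rV[R]_d.

(* Near each boundary point p, Omega is the strict epigraph, in the direction
   of a unit vector e, of a Lipschitz function of the component of y - p
   orthogonal to e. *)
Definition lipschitz_boundary Omega : Prop :=
  forall p, (closure Omega `\` Omega) p ->
  exists (e : 'rV[R]_d) (gamma : 'rV[R]_d -> R) (r : R),
    [/\ enorm e = 1, lipschitz gamma, 0 < r &
        forall y, enorm (y - p) < r ->
          Omega y <->
          gamma (y - p - dot (y - p) e *: e) < dot (y - p) e].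

Definition bounded_lipschitz_domain Omega : Prop :=
  [/\ Omega !=set0, open Omega, connected Omega, bounded_set Omega &
      lipschitz_boundary Omega].

Definition homeomorphic_to_ball Omega : Prop :=
  let B := [set x : 'rV[R]_d | enorm x < 1] in
  exists f g : 'rV[R]_d -> 'rV[R]_d,
    [/\ {within Omega, continuous f} /\ {within B, continuous g},
        f @` Omega `<=` B, g @` B `<=` Omega,
        {in Omega, cancel f g} & {in B, cancel g f}].

End domains.

Section function_spaces.
Variables (R : realType) (d : nat) (Omega : set 'rV[R]_d).
Implicit Types f g : 'rV[R]_d -> R.

Definition L2 f : Prop :=
  measurable_fun Omega f /\
  (lebesgue_row R d).-integrable Omega (fun x => (f x ^+ 2)%:E).

Definition Linfty f : Prop :=
  measurable_fun Omega f /\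
  exists M : R, {ae lebesgue_row R d, forall x, Omega x -> `|f x| <= M}.

Definition weak_partial (i : 'I_d) f g : Prop :=
  forall phi, test_function Omega phi ->
    (\int[lebesgue_row R d]_(x in Omega) (f x * partial i phi x)%:E =
     - \int[lebesgue_row R d]_(x in Omega) (g x * phi x)%:E)%E.

Definition H1 f : Prop :=
  L2 f /\ forall i, exists2 g, L2 g & weak_partial i f g.

(* The k-th component of curl H is 'd_i H_j - 'd_j H_i, where (i, j) is
   (k + 1, k + 2) modulo 3 if d = 3, and (0, 1) if d = 2; the curl of a planar
   field has 'C(2, 2) = 1 component, and that of a spatial one 'C(3, 2) = 3. *)
Definition curl_indices (k i j : nat) : bool :=
  if d == 2%N then (i == 0%N) && (j == 1%N)
  else (i == (k + 1) %% 3)%N && (j == (k + 2) %% 3)%N.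

Definition weak_curl (H : 'rV[R]_d -> 'rV[R]_d)
    (c : 'rV[R]_d -> 'rV[R]_('C(d, 2))) : Prop :=
  (forall k, L2 (fun x => c x ord0 k)) /\
  forall (k : 'I_('C(d, 2))) (i j : 'I_d), curl_indices k i j ->
  forall phi, test_function Omega phi ->
    (\int[lebesgue_row R d]_(x in Omega) (c x ord0 k * phi x)%:E =
     \int[lebesgue_row R d]_(x in Omega)
       (H x ord0 i * partial j phi x - H x ord0 j * partial i phi x)%:E)%E.

Definition Hcurl (H : 'rV[R]_d -> 'rV[R]_d) : Prop :=
  (forall i, L2 (fun x => H x ord0 i)) /\ exists c, weak_curl H c.

End function_spaces.

Section convex_analysis.
Variables (R : realType) (d : nat).
Implicit Types f : 'rV[R]_d -> \bar R.

Definition edom f : set 'rV[R]_d := [set J | f J < +oo]%E.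

Definition closed_fun f : Prop :=
  closed [set p : 'rV[R]_d * R | (f p.1 <= p.2%:E)%E].

Definition convex_efun f : Prop := forall (x y : 'rV[R]_d) (t : R),
  0 <= t <= 1 ->
  (f (t *: x + (1 - t) *: y)%R <= t%:E * f x + (1 - t)%:E * f y)%E.

Definition strongly_convex (sigma : R) f : Prop :=
  convex_efun (fun J => f J - (sigma / 2 * enorm J ^+ 2)%:E)%E.

(* Twice differentiability at a point of the domain makes sense for interior
   points only, hence the requirement that the domain be open. *)
Definition regular_energy (sigma : R) f : Prop :=
  [/\ edom f !=set0, closed_fun f, strongly_convex sigma f,
      open (edom f) & C2_on (edom f) (fine \o f)].

End convex_analysis.

(* Hs is the source field and Jp the previous state of the polarization; all
   functions of the position are total, only their values on Omega matter. *)
Record model (R : realType) (d : nat) := Model {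
  Omega : set 'rV[R]_d ;
  mu0 : R ;
  chi : 'rV[R]_d -> R ;
  U : 'rV[R]_d -> 'rV[R]_d -> \bar R ;
  Jp : 'rV[R]_d -> 'rV[R]_d ;
  Hs : 'rV[R]_d -> 'rV[R]_d }.

Section constitutive_law.
Variables (R : realType) (d : nat) (M : model R d).
Implicit Types x H J : 'rV[R]_d.

Definition inner_energy x H J : \bar R :=
  (U M x J - (dot H J)%:E + (chi M x * enorm (J - Jp M x))%:E)%E.

Definition coenergy x H : R :=
  mu0 M / 2 * enorm H ^+ 2 - fine (ereal_inf (range (inner_energy x H))).

Definition polarization x H : 'rV[R]_d :=
  get [set J | forall J', (inner_energy x H J <= inner_energy x H J')%E].

(* For row vectors, a (x) b = a b^T is the matrix a^T *m b. *)
Definition newton_matrix x H : 'M[R]_d :=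
  let J := polarization x H in
  let D := J - Jp M x in
  if J == Jp M x then (mu0 M)%:M
  else (mu0 M)%:M +
    invmx (hess (fine \o U M x) J +
           (chi M x / enorm D) *: (1%:M - (enorm D ^+ 2)^-1 *: (D^T *m D))).

End constitutive_law.

(* A mesh is the list of its cells; a cell is given by the rows of a
   (d + 1) x d matrix, its vertices. *)
Record mesh (R : realType) (d : nat) := Mesh {
  ncells : nat ;
  cell : 'I_ncells -> 'M[R]_(d.+1, d) }.

Arguments cell {R d} m k.

Section simplices.
Variables (R : realType) (d : nat).
Implicit Types T : 'M[R]_(d.+1, d).

Definition face T (A : {set 'I_d.+1}) : set 'rV[R]_d :=
  [set x | exists l : 'rV[R]_d.+1,
    [/\ forall i, 0 <= l ord0 i, \sum_i l ord0 i = 1,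
        forall i, i \notin A -> l ord0 i = 0 & x = l *m T]].

Definition simplex T : set 'rV[R]_d := face T [set: 'I_d.+1]%SET.

Definition nondegenerate T : Prop :=
  (\matrix_(i < d, j < d) (T (lift ord0 i) j - T ord0 j)) \in unitmx.

Definition barycenter T : 'rV[R]_d := (d.+1)%:R^-1 *: \sum_i row i T.

Definition volume T : R := fine (lebesgue_row R d (simplex T)).

End simplices.

Section finite_elements.
Variables (R : realType) (d : nat).
Implicit Types (Omega : set 'rV[R]_d) (Th : mesh R d).

Definition conforming_partition Omega Th : Prop :=
  [/\ forall k, nondegenerate (cell Th k),
      closure Omega = \bigcup_k simplex (cell Th k),
      forall k, (simplex (cell Th k))° `<=` Omega,
      forall k l, k != l ->
        (simplex (cell Th k))° `&` (simplex (cell Th l))° = set0 &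
      forall k l, k != l -> exists A B,
        simplex (cell Th k) `&` simplex (cell Th l) = face (cell Th k) A /\
        face (cell Th k) A = face (cell Th l) B].

(* On each open cell, f coincides with a continuous function on the closed
   cell; the values on the skeleton are irrelevant. *)
Definition piecewise_continuous (Y : topologicalType) Th
    (f : 'rV[R]_d -> Y) : Prop :=
  forall k, exists g : 'rV[R]_d -> Y,
    {within simplex (cell Th k), continuous g} /\
    forall x, (simplex (cell Th k))° x -> f x = g x.

Definition affine_on (A : set 'rV[R]_d) (v : 'rV[R]_d -> R) : Prop :=
  exists (a : 'rV[R]_d) (b : R), forall x, A x -> v x = dot a x + b.

Definition Vh Omega Th (v : 'rV[R]_d -> R) : Prop :=
  [/\ H1 Omega v, (\int[lebesgue_row R d]_(x in Omega) (v x)%:E = 0)%E &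
      forall k, affine_on (simplex (cell Th k)) v].

Definition quadrature Th (f : 'rV[R]_d -> R) : R :=
  \sum_(k < ncells Th) f (barycenter (cell Th k)) * volume (cell Th k).

Definition hdot Th (u v : 'rV[R]_d -> 'rV[R]_d) : R :=
  quadrature Th (fun x => dot (u x) (v x)).

Definition hnorm Th (u : 'rV[R]_d -> 'rV[R]_d) : R := Num.sqrt (hdot Th u u).

(* The size of a potential is that of its gradient field: on potentials
   themselves the barycenter quadrature is degenerate, since a nonzero element
   of Vh may vanish at all barycenters. *)
Definition potential_norm Th (v : 'rV[R]_d -> R) : R := hnorm Th (grad v).

End finite_elements.

Section newton.
Variables (R : realType) (d : nat) (M : model R d) (Th : mesh R d).
Variables (sigmaA rho : R).
Implicit Types psi dpsi v : 'rV[R]_d -> R.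

Definition magnetic_field psi x : 'rV[R]_d := Hs M x - grad psi x.

Definition discrete_solution psi : Prop :=
  Vh (Omega M) Th psi /\
  forall v, Vh (Omega M) Th v ->
    hdot Th (fun x => grad (coenergy M x) (magnetic_field psi x)) (grad v) = 0.

Definition newton_direction psi dpsi : Prop :=
  Vh (Omega M) Th dpsi /\
  forall v, Vh (Omega M) Th v ->
    hdot Th (fun x => grad dpsi x *m (newton_matrix M x (magnetic_field psi x))^T)
            (grad v) =
    hdot Th (fun x => grad (coenergy M x) (magnetic_field psi x)) (grad v).

Definition search_direction psi : 'rV[R]_d -> R := get (newton_direction psi).

Definition merit psi dpsi (tau : R) : R :=
  quadrature Th (fun x => coenergy M x (magnetic_field (psi + tau *: dpsi) x)).

(* The maximum of the set of admissible steps: the steps rho ^+ m have no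
   accumulation point but 0, so that the supremum is attained as soon as one of
   them is admissible. *)
Definition armijo_step psi : R :=
  let Phi := merit psi (search_direction psi) in
  sup [set tau | exists2 m : nat, tau = rho ^+ m &
                 Phi tau <= Phi 0 + sigmaA * tau * derive1 Phi 0].

Definition newton_step psi : 'rV[R]_d -> R :=
  psi + armijo_step psi *: search_direction psi.

Definition newton_iterate psi0 n : 'rV[R]_d -> R := iter n newton_step psi0.

End newton.

(* Main.v *)
(* At a quadrature point the polarization J(H) minimizes the strongly convex
   function U - <H, .> + chi |. - Jp|.  Hence H |-> J(H) is Lipschitz with constant
   1 / sigma and is the gradient of the conjugate function, so that w^* is strongly
   convex with modulus mu0 and has a Lipschitz gradient B(H) = mu0 H + J(H); the
   Newton matrices satisfy mu0 <= S <= mu0 + 1 / sigma.  Armijo backtracking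
   therefore accepts steps bounded below independently of the mesh, and each step
   reduces the excess of the total co-energy over its minimum by a fixed factor.

   Locally, the field at J is grad U(J) + p with p in chi times the
   subdifferential of the norm at J - Jp.  The curvature of the norm absorbs the
   variation of p, even when J tends to Jp, which gives the semismoothness
     B(H) - B(H0) = S(H) (H - H0) + o(|H - H0|)
   and hence superlinear convergence of the full Newton steps.  The same analysis
   gives the trapezoidal rule
     w^*(H) - w^*(H0) = <B(H) + B(H0), H - H0> / 2 + o(|H - H0|^2),
   by which a full Newton step decreases the total co-energy by almost half of the
   predicted slope; it is accepted since sigmaA < 1/2. *)
Require Import Defs.
From HB Require Import structures.
From mathcomp Require Import all_boot all_order all_algebra.
From mathcomp Require Import all_classical all_reals all_analysis.
From mathcomp Require Import measurable_realfun.
From mathcomp Require Import ring lra.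

Set Implicit Arguments.
Unset Strict Implicit.
Unset Printing Implicit Defensive.

Import Order.TTheory GRing.Theory Num.Theory.
Import numFieldNormedType.Exports.

Local Open Scope classical_set_scope.
Local Open Scope ring_scope.

(** * Euclidean geometry of row vectors *)

(** The obstacle is the kink of the norm at J = Jp, where the curvature chi / |J - Jp| blows up if
    chi > 0, so that continuity of the Hessian is of no use there. Both local expansions rest on a
    dichotomy instead: near H0 either J = J0 = Jp, or J differs from Jp and both multipliers p, p0
    have norm exactly chi. Two points of a sphere differ tangentially up to second order, so what
    the curvature leaves over is of higher order, also in the borderline case J0 = Jp, |p0| = chi.

    As w^* need not be twice differentiable, a Taylor expansion cannot decide whether the full step
    is accepted. The trapezoidal rule involves B at the two ends only, and there the Newton equation
    and the orthogonality of the discrete solution evaluate it.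

    Scaling by the square roots of the cell volumes turns the discrete problem into one on a
    subspace of R^(N d) with its Euclidean product. The global constants then involve mu0, sigma,
    sigmaA and rho only; the radius of the local regime may depend on the mesh. *)

Section euclidean_theory.
Variables (R : realType) (n : nat).
Implicit Types (u v w : 'rV[R]_n) (a b : R).

Lemma dotC u v : dot u v = dot v u.
Proof. by apply: eq_bigr => i _; rewrite mulrC. Qed.

Lemma dotDl u v w : dot (u + v) w = dot u w + dot v w.
Proof. by rewrite -big_split/=; apply: eq_bigr => i _; rewrite mxE mulrDl. Qed.

Lemma dotZl a u v : dot (a *: u) v = a * dot u v.
Proof. by rewrite mulr_sumr; apply: eq_bigr => i _; rewrite mxE mulrA. Qed.

Lemma dotDr u v w : dot u (v + w) = dot u v + dot u w.
Proof. by rewrite dotC dotDl !(dotC u). Qed.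

Lemma dotZr a u v : dot u (a *: v) = a * dot u v.
Proof. by rewrite dotC dotZl dotC. Qed.

Lemma dotNl u v : dot (- u) v = - dot u v.
Proof. by rewrite -scaleN1r dotZl mulN1r. Qed.

Lemma dotNr u v : dot u (- v) = - dot u v.
Proof. by rewrite dotC dotNl dotC. Qed.

Lemma dot0l u : dot 0 u = 0.
Proof. by rewrite -(scale0r 0) dotZl mul0r. Qed.

Lemma dot0r u : dot u 0 = 0.
Proof. by rewrite dotC dot0l. Qed.

Definition dotE := (dotDl, dotDr, dotNl, dotNr, dotZl, dotZr).

Lemma dot_ge0 u : 0 <= dot u u.
Proof. by apply: sumr_ge0 => i _; rewrite -expr2 sqr_ge0. Qed.

Lemma enorm_ge0 u : 0 <= enorm u.
Proof. exact: sqrtr_ge0. Qed.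

Lemma enorm_sqr u : enorm u ^+ 2 = dot u u.
Proof. by rewrite sqr_sqrtr// dot_ge0. Qed.

Lemma dot_eq0 u : dot u u = 0 -> u = 0.
Proof.
move/eqP; rewrite psumr_eq0 => [/allP u0|i _]; last by rewrite -expr2 sqr_ge0.
apply/rowP => i; rewrite mxE; apply/eqP.
by have := u0 i (mem_index_enum i); rewrite /= mulf_eq0 orbb.
Qed.

Lemma enorm0 : enorm (0 : 'rV[R]_n) = 0.
Proof. by rewrite /enorm dot0l sqrtr0. Qed.

Lemma enorm_eq0 u : enorm u = 0 -> u = 0.
Proof. by move=> u0; apply: dot_eq0; rewrite -enorm_sqr u0 expr0n. Qed.

Lemma enorm_gt0 u : u != 0 -> 0 < enorm u.
Proof.
by move=> u0; rewrite lt_def enorm_ge0 andbT; apply: contra u0 => /eqP/enorm_eq0 ->.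
Qed.

Lemma enormN u : enorm (- u) = enorm u.
Proof. by rewrite /enorm dotNl dotNr opprK. Qed.

Lemma enorm_distC u v : enorm (u - v) = enorm (v - u).
Proof. by rewrite -enormN opprB. Qed.

Lemma enormZ a u : enorm (a *: u) = `|a| * enorm u.
Proof. by rewrite /enorm dotZl dotZr mulrA -expr2 sqrtrM ?sqr_ge0// sqrtr_sqr. Qed.

Lemma le_enorm_of_sqr u a : 0 <= a -> dot u u <= a ^+ 2 -> enorm u <= a.
Proof. by move=> a0 ua; rewrite -(@ler_pXn2r _ 2)// ?nnegrE ?enorm_ge0// enorm_sqr. Qed.

Lemma cauchy_schwarz u v : dot u v <= enorm u * enorm v.
Proof.
have := dot_ge0 (enorm v *: u - enorm u *: v).
rewrite !dotE -!enorm_sqr (dotC v u) => h.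
have [u0|u0] := eqVneq u 0; first by rewrite u0 dot0l mulr_ge0 ?enorm_ge0.
have [v0|v0] := eqVneq v 0; first by rewrite v0 dot0r mulr_ge0 ?enorm_ge0.
have uv : 0 < enorm u * enorm v by rewrite mulr_gt0// enorm_gt0.
rewrite -subr_ge0 -(pmulr_rge0 _ uv); nra.
Qed.

Lemma cauchy_schwarz_abs u v : `|dot u v| <= enorm u * enorm v.
Proof.
rewrite ler_norml cauchy_schwarz andbT lerNl -dotNl -(enormN u).
exact: cauchy_schwarz.
Qed.

Lemma enormD u v : enorm (u + v) <= enorm u + enorm v.
Proof.
apply: le_enorm_of_sqr; first by rewrite addr_ge0 ?enorm_ge0.
rewrite !dotE (dotC v u) sqrrD !enorm_sqr.
by have := cauchy_schwarz u v; lra.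
Qed.

Lemma enormB u v : enorm (u - v) <= enorm u + enorm v.
Proof. by rewrite -(enormN v) enormD. Qed.

Lemma enorm_triangle w u v : enorm (u - v) <= enorm (u - w) + enorm (w - v).
Proof. by rewrite -[u - v](subrKA w) enormD. Qed.

Lemma normr_le_enorm u : `|u| <= enorm u.
Proof.
rewrite [leLHS]mx_normrE; apply/bigmax_leP; split=> [|[i j] _ /=]; first exact: enorm_ge0.
rewrite -(@ler_pXn2r _ 2)// ?nnegrE ?enorm_ge0// enorm_sqr real_normK ?num_real//.
rewrite (ord1 i) /dot (bigD1 j)//= -expr2 lerDl.
by apply: sumr_ge0 => k _; rewrite -expr2 sqr_ge0.
Qed.

Lemma coord_le_norm m p (A : 'M[R]_(m, p)) i j : `|A i j| <= `|A|.
Proof.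
by rewrite [leRHS]mx_normrE; apply: (le_bigmax _ (fun k => `|A k.1 k.2|) (i, j)).
Qed.

Lemma enorm_le_normr u : enorm u <= n.+1%:R * `|u|.
Proof.
apply: le_enorm_of_sqr; first by rewrite mulr_ge0.
apply: (@le_trans _ _ (\sum_(i < n) `|u| ^+ 2)).
  apply: ler_sum => i _; rewrite -expr2 -(@real_normK _ (u ord0 i)) ?num_real//.
  by rewrite ler_pXn2r ?nnegrE// coord_le_norm.
rewrite sumr_const card_ord exprMn -[leLHS]mulr_natl; apply: ler_wpM2r; first exact: sqr_ge0.
by rewrite -natrX ler_nat expnS expn1 (leq_trans (leqnSn n))// leq_pmulr.
Qed.

Lemma enorm_ball (x : 'rV[R]_n) (e : R) : 0 < e ->
  nbhs x [set y : 'rV[R]_n | enorm (y - x) < e].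
Proof.
move=> e0; apply/nbhs_ballP; exists (e / n.+1%:R) => /=; first by rewrite divr_gt0.
move=> y; rewrite -ball_normE /= distrC ltr_pdivlMr// mulrC.
exact/le_lt_trans/enorm_le_normr.
Qed.

Lemma nbhs_enorm (x : 'rV[R]_n) (A : set 'rV[R]_n) : nbhs x A ->
  exists2 e : R, 0 < e & forall y, enorm (y - x) < e -> A y.
Proof.
move=> /nbhs_ballP[e /= e0 eA]; exists e => // y ye; apply: eA.
by rewrite -ball_normE/= distrC (le_lt_trans (normr_le_enorm _)).
Qed.

End euclidean_theory.

Lemma enorm_mulmx (R : realType) (m n : nat) (u : 'rV[R]_m) (A : 'M[R]_(m, n)) :
  enorm (u *m A) <= n.+1%:R * m%:R * `|A| * enorm u.
Proof.
apply: (le_trans (enorm_le_normr _)); rewrite -!mulrA ler_wpM2l//.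
rewrite [`|u *m A|]mx_normrE; apply/bigmax_leP; split.
  by rewrite !mulr_ge0// enorm_ge0.
move=> [i j] _ /=; rewrite mxE.
apply: (le_trans (ler_norm_sum _ _ _)).
apply: (@le_trans _ _ (\sum_(k < m) `|A| * enorm u)); last first.
  by rewrite sumr_const card_ord mulr_natl.
apply: ler_sum => k _; rewrite normrM mulrC ler_pM// ?coord_le_norm//.
exact: le_trans (coord_le_norm _ _ _) (normr_le_enorm _).
Qed.

(** * First and second order approximation *)

Section first_order.
Variables (R : realType) (n : nat).
Implicit Types (x y v : 'rV[R]_n) (f : 'rV[R]_n -> R).

Lemma diff_approx (W : normedModType R) (f : 'rV[R]_n -> W) x (e : R) :
  differentiable f x -> 0 < e ->
  exists2 delta : R, 0 < delta & forall y, enorm (y - x) < delta ->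
    `|f y - f x - 'd f x (y - x)| <= e * enorm (y - x).
Proof.
move=> /diff_locally/eqaddoP/(_ _ _)/[swap] e0 => /(_ _ e0).
move=> /(@nbhs_enorm _ _ _ _)[delta delta0 H]; exists delta => // y yd.
have := H (y - x); rewrite subr0 => /(_ yd) /=.
rewrite -![(_ - _ : _ -> _) _]/(_ - _) /= subrK opprD addrA => /le_trans; apply.
by rewrite ler_pM2l// normr_le_enorm.
Qed.

Lemma row_basis_sum v : v = \sum_(i < n) v ord0 i *: basis_row R i.
Proof. exact: row_sum_delta. Qed.

Lemma diff_grad f x v : differentiable f x -> 'd f x v = dot (grad f x) v.
Proof.
move=> df; rewrite [in LHS](row_basis_sum v) linear_sum; apply: eq_bigr => i _.
by rewrite linearZ -deriveE// mxE mulrC.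
Qed.

Lemma diff_hess f x v : differentiable (grad f) x ->
  'd (grad f) x v = v *m (hess f x)^T.
Proof.
move=> df; rewrite [in LHS](row_basis_sum v) linear_sum; apply/rowP => i.
rewrite mxE summxE; apply: eq_bigr => j _.
have -> : 'd (grad f) x (v ord0 j *: basis_row R j) =
    v ord0 j *: 'D_(basis_row R j) (grad f) x by rewrite linearZ deriveE.
rewrite derive_mx; last exact: diff_derivable.
have gE : (fun z => grad f z ord0 i) = partial i f.
  by apply/funext => z; rewrite mxE.
by rewrite !mxE gE.
Qed.

Lemma grad_approx f x (e : R) : differentiable f x -> 0 < e ->
  exists2 delta : R, 0 < delta & forall y, enorm (y - x) < delta ->
    `|f y - f x - dot (grad f x) (y - x)| <= e * enorm (y - x).
Proof.
move=> df /(diff_approx df)[delta ? H]; exists delta => // y /H.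
by rewrite diff_grad.
Qed.

Lemma hess_approx f x (e : R) : differentiable (grad f) x -> 0 < e ->
  exists2 delta : R, 0 < delta & forall y, enorm (y - x) < delta ->
    enorm (grad f y - grad f x - (y - x) *m (hess f x)^T) <= e * enorm (y - x).
Proof.
move=> df e0; have e'0 : 0 < e / n.+1%:R by rewrite divr_gt0.
have [delta ? H] := diff_approx df e'0; exists delta => // y /H.
rewrite diff_hess// => {}H; apply: (le_trans (enorm_le_normr _)).
by rewrite mulrC -ler_pdivlMr// mulrAC.
Qed.

Lemma hess_continuous_approx f x (e : R) : {for x, continuous (hess f)} -> 0 < e ->
  exists2 delta : R, 0 < delta & forall y, enorm (y - x) < delta ->
    forall v, enorm (v *m (hess f y)^T - v *m (hess f x)^T) <= e * enorm v.
Proof.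
move=> cf e0; have c0 : 0 < n.+1%:R * n.+1%:R :> R by rewrite mulr_gt0.
have e'0 : 0 < e / (n.+1%:R * n.+1%:R) by rewrite divr_gt0.
have /nbhs_enorm[delta d0 H] : \forall y \near x,
    `|hess f x - hess f y| < e / (n.+1%:R * n.+1%:R).
  move: cf => /cvgrPdist_lt H; exact: (H _ e'0).
exists delta => // y /H/= {}H v.
rewrite -mulmxBr -linearB/=; apply: (le_trans (enorm_mulmx _ _)).
rewrite ler_wpM2r ?enorm_ge0//.
have -> : `|(hess f y - hess f x)^T| = `|hess f y - hess f x|.
  apply/eqP; rewrite eq_le; apply/andP; split; rewrite [leLHS]mx_normrE;
    apply/bigmax_leP; split => // -[i j] _ /=; first by rewrite mxE coord_le_norm.
  by have := coord_le_norm (hess f y - hess f x)^T j i; rewrite mxE.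
rewrite distrC ltr_pdivlMr// in H.
apply: (@le_trans _ _ (`|hess f y - hess f x| * (n.+1%:R * n.+1%:R))); last exact: ltW.
by rewrite mulrC; apply: ler_wpM2l => //; apply: ler_wpM2l => //; rewrite ler_nat.
Qed.

(** This takes the place of an envelope theorem: the co-energy and the merit function are never
    differentiated directly, a quadratic bound on their deviation from a linear function identifies
    the derivative. *)
Lemma derive_of_quadratic_bound (V : normedModType R) (g : V -> R) (p v : V) (c C : R) :
  (forall h : R, `|g (h *: v + p) - g p - h * c| <= C * h ^+ 2) -> 'D_v g p = c.
Proof.
move=> H; apply: cvg_lim => //; apply/cvgrPdist_le => e e0.
have C0 : 0 <= C by have := H 1; rewrite expr1n mulr1; exact: le_trans.
have e1 : 0 < e / (C + 1) by rewrite divr_gt0// ltr_wpDl.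
near=> h; have h0 : h != 0 by near: h; exact: nbhs_dnbhs_neq.
have he : `|h| <= e / (C + 1).
  near: h; apply/nbhs_ballP; exists (e / (C + 1)) => //= h.
  by rewrite /ball/= sub0r normrN => /ltW.
rewrite distrC -(ler_pM2l (_ : 0 < `|h|)) ?normr_gt0// -normrM mulrBr.
rewrite [X in X - _]mulrA divff// mul1r (le_trans (H h))//.
rewrite -(@real_normK _ h) ?num_real// expr2 mulrCA ler_wpM2l//.
rewrite ler_pdivlMr ?ltr_wpDl// in he.
by rewrite (le_trans _ he)// mulrDr mulr1 mulrC lerDl.
Unshelve. all: by end_near. Qed.

End first_order.

(** * Strongly convex energies *)

Lemma ler_of_eps (R : realType) (K a b : R) :
  (forall e, 0 < e -> a <= b + e * K) -> a <= b.
Proof.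
move=> H; apply/ler_addgt0Pr => e e0.
have K0 : 0 < `|K| + 1 by rewrite ltr_wpDl.
apply: (le_trans (H (e / (`|K| + 1)) _)); first by rewrite divr_gt0.
rewrite lerD2l mulrAC ler_pdivrMr// ler_pM2l// (le_trans (ler_norm K))//.
by rewrite lerDl.
Qed.

Lemma is_derive_line (R : realType) (V W : normedModType R) (g : V -> W) (x w : V) (t : R) :
  derivable g (x + t *: w) w ->
  is_derive t 1 (fun s : R => g (x + s *: w)) ('D_w g (x + t *: w)).
Proof.
move=> dg; have E : (fun h : R => h^-1 *: (g (x + (h *: (1 : R) + t) *: w) - g (x + t *: w))) =
    (fun h => h^-1 *: (g (h *: w + (x + t *: w)) - g (x + t *: w))).
  by apply/funext => h; rewrite [h *: 1]mulr1 scalerDl addrCA.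
by split; rewrite /derivable /derive /= E.
Qed.

Section strongly_convex_energy.
Variables (R : realType) (n : nat) (sigma : R) (f : 'rV[R]_n -> \bar R).
Hypothesis sigma_gt0 : 0 < sigma.
Hypothesis f_gtNy : forall J, (-oo < f J)%E.
Hypothesis f_reg : regular_energy sigma f.

Let D := edom f.
Let u := fine \o f.
Implicit Types (x y v w H J : 'rV[R]_n).

Lemma energy_fineE x : D x -> f x = (u x)%:E.
Proof. by move=> Dx; rewrite /u/= fineK// fin_real// f_gtNy. Qed.

Lemma energy_convex x y (t : R) : D x -> D y -> 0 <= t <= 1 ->
  D (x + t *: (y - x)) /\
  u (x + t *: (y - x)) <=
    (1 - t) * u x + t * u y - sigma / 2 * (t * (1 - t)) * dot (y - x) (y - x).
Proof.
move=> Dx Dy t01; have [_ _ /(_ y x t t01) + _ _] := f_reg.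
have -> : t *: y + (1 - t) *: x = x + t *: (y - x).
  by rewrite scalerBr scalerBl scale1r addrCA addrA addrAC.
rewrite (energy_fineE Dx) (energy_fineE Dy) -!EFinB -!EFinM -EFinD.
set z := x + _ => h.
have Dz : D z.
  rewrite /D /edom /=; by case: (f z) h => [r _| |_]; [exact: ltry| |].
split => //; move: h; rewrite (energy_fineE Dz) -EFinB lee_fin !enorm_sqr.
rewrite /z !dotE !(dotC y x) => h; nra.
Qed.

Lemma energy_open x : D x ->
  exists2 e : R, 0 < e & forall y, enorm (y - x) < e -> D y.
Proof. by move=> Dx; have [_ _ _ oD _] := f_reg; apply: nbhs_enorm; exact: oD. Qed.

Lemma energy_C2 x : D x -> [/\ differentiable u x, differentiable (grad u) x &
  {for x, continuous (hess u)}].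
Proof. by move=> Dx; have [_ _ _ _] := f_reg; exact. Qed.

(** Step lengths for difference quotients: the moved point stays in a given neighbourhood, and the
    bound by [e] makes terms of second order in [t] negligible after division by [t]. *)
Lemma small_step v (delta e : R) : 0 < delta -> 0 < e ->
  exists t : R, [/\ 0 < t, t <= 1, t <= e & enorm (t *: v) < delta].
Proof.
move=> d0 e0; have v0 : 0 < enorm v + 1 by rewrite ltr_wpDl ?enorm_ge0.
exists (Num.min (Num.min 1 e) (delta / (enorm v + 1))); split.
- by rewrite !lt_min ltr01 e0 divr_gt0.
- by rewrite !ge_min lexx.
- by rewrite !ge_min lexx orbT.
rewrite enormZ ger0_norm; last by rewrite !le_min ler01 (ltW e0) divr_ge0 ?ltW.
apply: (@le_lt_trans _ _ (delta / (enorm v + 1) * enorm v)).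
  by rewrite ler_wpM2r ?enorm_ge0// ge_min lexx orbT.
by rewrite mulrAC ltr_pdivrMr// ltr_pM2l// ltrDl.
Qed.

(** Strong convexity along the segment, divided by [t], as [t] tends to 0. The constant given to
    [ler_of_eps] collects the error of the linearization and the part of the modulus lost to the
    factor [1 - t]. *)
Lemma energy_grad_le x y : D x -> D y ->
  u x + dot (grad u x) (y - x) + sigma / 2 * dot (y - x) (y - x) <= u y.
Proof.
move=> Dx Dy; apply: (@ler_of_eps _ (enorm (y - x) + sigma / 2 * dot (y - x) (y - x))).
move=> e e0; have [du _ _] := energy_C2 Dx.
have [delta d0 Hd] := grad_approx du e0.
have [t [t0 t1 te td]] := small_step (y - x) d0 e0.
have [|_ cv] := energy_convex Dx Dy (t := t); first by rewrite ltW.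
have := Hd (x + t *: (y - x)); rewrite addrC addKr => /(_ td).
rewrite enormZ (ger0_norm (ltW t0)) dotZr ler_norml => /andP[lo _].
have s0 := dot_ge0 (y - x).
rewrite -(ler_pM2l t0); set q := dot (y - x) (y - x) in cv s0 *.
have : t * (t * (sigma / 2 * q)) <= t * (e * (sigma / 2 * q)).
  by rewrite ler_pM2l// ler_wpM2r// mulr_ge0// divr_ge0// ltW.
by move: lo cv; lra.
Qed.

Lemma energy_grad_mono x y : D x -> D y ->
  sigma * dot (y - x) (y - x) <= dot (grad u y - grad u x) (y - x).
Proof.
move=> Dx Dy; have := energy_grad_le Dx Dy; have := energy_grad_le Dy Dx.
rewrite -(opprB y x) !(dotNl, dotNr, dotDl (grad u y)); lra.
Qed.

Lemma energy_hess_ge x v : D x ->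
  sigma * dot v v <= dot (v *m (hess u x)^T) v.
Proof.
move=> Dx; apply: (@ler_of_eps _ (enorm v * enorm v)) => e e0.
have [_ du _] := energy_C2 Dx.
have [delta d0 Hd] := hess_approx du e0; have [d' d'0 HD] := energy_open Dx.
have [|t [t0 _ _ td]] := @small_step v (Num.min delta d') 1 _ ltr01.
  by rewrite lt_min d0.
move: td; rewrite lt_min => /andP[td td'].
have xtv : x + t *: v - x = t *: v by rewrite addrC addKr.
have Dy : D (x + t *: v) by apply: HD; rewrite xtv.
have := Hd (x + t *: v); rewrite xtv => /(_ td) h.
have := energy_grad_mono Dx Dy; rewrite xtv.
have := cauchy_schwarz (grad u (x + t *: v) - grad u x - (t *: v) *m (hess u x)^T) v.
move=> /le_trans/(_ (ler_wpM2r (enorm_ge0 v) h)).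
rewrite enormZ (ger0_norm (ltW t0)) -scalemxAl dotDl dotNl !dotZl !dotZr => a b.
by rewrite -(ler_pM2l t0); nra.
Qed.

Lemma energy_grad_lipschitz x : D x -> exists K delta : R,
  [/\ 0 <= K, 0 < delta & forall y, enorm (y - x) < delta ->
    D y /\ enorm (grad u y - grad u x) <= K * enorm (y - x)].
Proof.
move=> Dx; have [_ du _] := energy_C2 Dx.
have [delta d0 Hd] := hess_approx du ltr01; have [d' d'0 HD] := energy_open Dx.
exists (1 + n.+1%:R * n%:R * `|(hess u x)^T|), (Num.min delta d'); split.
- by rewrite addr_ge0// !mulr_ge0.
- by rewrite lt_min d0.
move=> y; rewrite lt_min => /andP[yd yd']; split; first exact: HD.
rewrite -[X in enorm X](subrK ((y - x) *m (hess u x)^T)).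
by rewrite (le_trans (enormD _ _))// mulrDl lerD ?enorm_mulmx// Hd.
Qed.

Lemma energy_trapezoid x (e : R) : D x -> 0 < e ->
  exists2 delta : R, 0 < delta & forall y, enorm (y - x) < delta ->
   `|u y - u x - 2^-1 * dot (grad u x + grad u y) (y - x)| <= e * enorm (y - x) ^+ 2.
Proof.
move=> Dx e0; have [_ du _] := energy_C2 Dx; have e20 : 0 < e / 2 by rewrite divr_gt0.
have [delta d0 Hd] := hess_approx du e20; have [d' d'0 HD] := energy_open Dx.
exists (Num.min delta d'); first by rewrite lt_min d0.
move=> y; rewrite lt_min => /andP[yd yd'].
set w := y - x in yd yd' *; set q := dot (w *m (hess u x)^T) w.
pose g (t : R) := u (x + t *: w) - t * dot (grad u x) w - t ^+ 2 / 2 * q.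
pose g' (t : R) := dot (grad u (x + t *: w)) w - dot (grad u x) w - t * q.
have xtE t : x + t *: w - x = t *: w by rewrite addrC addKr.
have small (t : R) : 0 <= t <= 1 -> enorm (t *: w) <= enorm w.
  by move=> /andP[t0 t1]; rewrite enormZ ger0_norm// ler_piMl ?enorm_ge0.
have dg (t : R) : 0 <= t <= 1 -> is_derive t 1 g (g' t).
  move=> t01; have Dt : D (x + t *: w).
    by apply: HD; rewrite xtE; exact: le_lt_trans (small _ t01) yd'.
  have [dut _ _] := energy_C2 Dt.
  have du1 : is_derive t 1 (fun s : R => u (x + s *: w)) (dot (grad u (x + t *: w)) w).
    by rewrite -diff_grad// -deriveE//; apply: is_derive_line; exact: diff_derivable.
  rewrite /g; apply: is_derive_eq.
  by rewrite /g' /GRing.scale/= !mulr1; field.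
have [||c] := @MVT_segment _ g g' 0 1 ler01.
- by move=> t; rewrite in_itv/= => /andP[t0 t1]; apply: dg; rewrite !ltW.
- apply: continuous_in_subspaceT => t; rewrite inE/= in_itv/= => t01.
  have [dt _] := dg _ t01.
  exact/differentiable_continuous/derivable1_diffP.
rewrite in_itv/= subr0 mulr1 => c01 gE.
have bound (t : R) : 0 <= t <= 1 -> `|g' t| <= e / 2 * enorm w ^+ 2.
  move=> t01; have := Hd (x + t *: w); rewrite xtE.
  move=> /(_ (le_lt_trans (small _ t01) yd)) h.
  rewrite (_ : g' t =
    dot (grad u (x + t *: w) - grad u x - (t *: w) *m (hess u x)^T) w); last first.
    by rewrite /g' /q -scalemxAl !dotE; ring.
  rewrite (le_trans (cauchy_schwarz_abs _ _))//.
  rewrite expr2 mulrA ler_wpM2r ?enorm_ge0// (le_trans h)//.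
  by rewrite ler_wpM2l ?small// ltW.
have b1 := bound 1; have bc := bound _ c01.
move: b1; rewrite ler01 lexx => /(_ isT); rewrite /g' scale1r.
move: gE bc; rewrite /g scale1r scale0r addr0.
rewrite (_ : x + w = y); last by rewrite /w addrC subrK.
rewrite expr1n expr0n/= => gE.
rewrite -gE !ler_norml dotDl.
by move=> /andP[? ?] /andP[? ?]; apply/andP; split; lra.
Qed.

End strongly_convex_energy.

(** * Existence of the minimizing polarization *)

Section pinned_energy.
Variables (R : realType) (n : nat) (sigma c : R) (f : 'rV[R]_n -> \bar R) (q : 'rV[R]_n).
Hypothesis sigma_gt0 : 0 < sigma.
Hypothesis c_ge0 : 0 <= c.
Hypothesis f_gtNy : forall J, (-oo < f J)%E.
Hypothesis f_reg : regular_energy sigma f.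

Let D := edom f.
Let u := fine \o f.
Let fE x : D x -> f x = (u x)%:E := @energy_fineE R n f f_gtNy x.
Implicit Types (x y v w H J p : 'rV[R]_n).

Definition pinned_energy H J : \bar R :=
  (f J - (dot H J)%:E + (c * enorm (J - q))%:E)%E.

Let F H J : R := u J - dot H J + c * enorm (J - q).

Lemma pinned_energyE H J : D J -> pinned_energy H J = (F H J)%:E.
Proof. by move=> DJ; rewrite /pinned_energy fE. Qed.

(** The gain [sigma / 8], which is [sigma / 2] times 1/4, is what makes minimizing sequences
    Cauchy. *)
Lemma pinned_energy_midpoint H x y : D x -> D y ->
  D (x + 2^-1 *: (y - x)) /\
  F H (x + 2^-1 *: (y - x)) + sigma / 8 * dot (y - x) (y - x) <= (F H x + F H y) / 2.
Proof.
move=> Dx Dy; have half : 0 <= (2^-1 : R) <= 1 by apply/andP; split; lra.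
have [Dm um] := energy_convex f_gtNy f_reg Dx Dy half; split => //.
rewrite /F dotDr dotZr dotDr dotNr.
have nm : enorm (x + 2^-1 *: (y - x) - q) <= 2^-1 * enorm (x - q) + 2^-1 * enorm (y - q).
  have -> : x + 2^-1 *: (y - x) - q = 2^-1 *: (x - q) + 2^-1 *: (y - q).
    by apply/rowP => i; rewrite !mxE; field.
  by rewrite (le_trans (enormD _ _))// !enormZ ger0_norm.
have := ler_wpM2l c_ge0 nm; move: um; rewrite -/u; lra.
Qed.

Lemma pinned_energy_bounded H x : D x -> exists m : R, forall J, D J -> m <= F H J.
Proof.
move=> Dx; exists (u x - dot H x - dot (grad u x - H) (grad u x - H) / (2 * sigma)).
move=> J DJ; have := energy_grad_le sigma_gt0 f_gtNy f_reg Dx DJ; rewrite -/u.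
have c0 : 0 <= c * enorm (J - q) by rewrite mulr_ge0// enorm_ge0.
(* Completing the square: a quadratic with modulus [sigma] dominates any linear term. *)
have key z w : 0 <= sigma / 2 * dot z z + dot w z + dot w w / (2 * sigma).
  rewrite [X in 0 <= X](_ : _ = (2 * sigma)^-1 * dot (sigma *: z + w) (sigma *: z + w)).
    by rewrite mulr_ge0 ?dot_ge0// invr_ge0 mulr_ge0// ltW.
  by rewrite !dotE (dotC z w); field; rewrite gt_eqF.
have := key (J - x) (grad u x - H); rewrite (dotDl (grad u x)) (dotNl H) (dotDr H) dotNr.
by rewrite /F; lra.
Qed.

(** The direct method, with strong convexity instead of compactness. The limit could lie on the
    boundary of the domain, where [u] is not known to be continuous; closedness of the epigraph
    places it in the domain and provides lower semicontinuity. *)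
Lemma pinned_energy_min H : exists J, forall J', (pinned_energy H J <= pinned_energy H J')%E.
Proof.
have [[x0 Dx0] cf _ _ _] := f_reg.
have [m mF] := pinned_energy_bounded H Dx0.
pose E := [set F H J | J in D].
have hE : has_inf E.
  split; first by exists (F H x0), x0.
  by exists m => _ [J DJ <-]; exact: mF.
have Einf J : D J -> inf E <= F H J by move=> DJ; apply: ge_inf; [case: hE|exists J].
have /choice[s sP] : forall k : nat, exists J, D J /\ F H J < inf E + k.+1%:R^-1.
  move=> k; have k0 : 0 < k.+1%:R^-1 :> R by rewrite invr_gt0.
  by have [_ [J DJ <-] lt] := inf_adherent k0 hE; exists J.
(* The midpoint value is at least the infimum, so the gain at the midpoint is at most the mean of
   the two excesses, both below [k.+1%:R^-1]. *)
have sdist k l : (k <= l)%N ->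
    enorm (s l - s k) ^+ 2 <= 8 / sigma * k.+1%:R^-1.
  move=> kl; have [Dk Fk] := sP k; have [Dl Fl] := sP l.
  have [Dm Fm] := pinned_energy_midpoint H Dk Dl.
  have Em := Einf _ Dm.
  have lk : l.+1%:R^-1 <= k.+1%:R^-1 :> R by rewrite lef_pV2 ?posrE// ler_nat.
  rewrite -(ler_pM2l sigma_gt0) enorm_sqr mulrA (mulrCA sigma) divff ?gt_eqF// mulr1.
  by move: lk Fk Fl Em Fm; move: k.+1%:R^-1 l.+1%:R^-1 (inf E) (F H _) => a b ? ?; lra.
have : cvg (s @ \oo).
  apply/cauchy_cvgP/cauchy_exP => e e0.
  have e'0 : 0 < e ^+ 2 / (8 / sigma) by rewrite !divr_gt0// exprn_gt0.
  have [N _ HN] := near_infty_natSinv_lt (PosNum e'0).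
  exists (s N); exists N => // l /= Nl; rewrite -ball_normE/= distrC.
  apply: le_lt_trans (normr_le_enorm _) _.
  rewrite -(@ltr_pXn2r _ 2)// ?nnegrE ?enorm_ge0 ?(ltW e0)//.
  apply: (le_lt_trans (sdist _ _ Nl)).
  have := HN N (leqnn N) => /=.
  by rewrite ltr_pdivlMr ?divr_gt0// mulrC.
move=> /cvg_ex[J sJ].
(* Since [F H (s k)] tends to the infimum while its linear and norm terms converge, [u (s k)]
   converges too; thus the points [(s k, u (s k))] of the epigraph have a limit. *)
have uJ : u (s k) @[k --> \oo] --> inf E + dot H J - c * enorm (J - q).
  apply/cvgrPdist_le => e e0.
  have K0 : 0 < enorm H + c + 1 by rewrite ltr_wpDl// addr_ge0 ?enorm_ge0.
  have d0 : 0 < e / 2 / (enorm H + c + 1) by rewrite !divr_gt0.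
  have e20 : 0 < e / 2 by rewrite divr_gt0.
  near=> k; have [Dk Fk] := sP k; have Ek := Einf _ Dk.
  have ke : k.+1%:R^-1 < e / 2.
    by near: k; exact: (near_infty_natSinv_lt (PosNum e20)).
  have kd : enorm (s k - J) < e / 2 / (enorm H + c + 1).
    by near: k; apply: (sJ _ (enorm_ball J d0)).
  rewrite ltr_pdivlMr// in kd.
  have hH : `|dot H (s k - J)| <= enorm H * enorm (s k - J) := cauchy_schwarz_abs _ _.
  have l1 : enorm (s k - q) <= enorm (s k - J) + enorm (J - q) := enorm_triangle _ _ _.
  have l2 : enorm (J - q) <= enorm (s k - J) + enorm (s k - q).
    by rewrite (enorm_distC (s k) J) enorm_triangle.
  have := ler_wpM2l c_ge0 l1; have := ler_wpM2l c_ge0 l2.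
  move: hH kd Fk Ek; rewrite /F dotDr dotNr !ler_norml.
  move: ke (enorm_ge0 (s k - J)); move: k.+1%:R^-1 (inf E) (enorm (s k - J)) => a b z.
  by move=> ke z0 /andP[? ?] *; apply/andP; split; nra.
have DJ : (f J <= (inf E + dot H J - c * enorm (J - q))%:E)%E.
  apply: (@closed_cvg _ _ \oo _ (fun k => (s k, u (s k))) _ cf _ (J, _) (cvg_pair sJ uJ)).
  by near=> k; rewrite /= fE//; have [] := sP k.
have D_J : D J by rewrite /D/edom/=; exact: le_lt_trans DJ (ltry _).
exists J => J'; rewrite pinned_energyE//.
have [D'|ND'] := pselect (D J'); last first.
  rewrite /pinned_energy; move: ND' (f_gtNy J'); rewrite /D /edom /=.
  case: (f J') => [r /(_ (ltry _))//| |//] _ _; exact: leey.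
rewrite pinned_energyE// lee_fin (le_trans _ (Einf _ D'))//.
by move: DJ; rewrite fE// lee_fin /F; lra.
Unshelve. all: by end_near. Qed.

End pinned_energy.

(** * Stationarity of the polarization *)

Section norm_subdifferential.
Variables (R : realType) (n : nat) (c : R).
Hypothesis c_ge0 : 0 <= c.
Implicit Types (v w p : 'rV[R]_n).

(* p lies in the subdifferential at v of c |.|. *)
Definition subnorm v p : Prop := enorm p <= c /\ dot p v = c * enorm v.

Lemma subnorm_le v w p : subnorm v p -> c * enorm v + dot p (w - v) <= c * enorm w.
Proof.
move=> [pc pv]; rewrite dotDr dotNr pv addrC subrK (le_trans (cauchy_schwarz _ _))//.
by rewrite ler_wpM2r// enorm_ge0.
Qed.

Lemma subnorm_mono v v0 p p0 : subnorm v p -> subnorm v0 p0 ->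
  0 <= dot (p - p0) (v - v0).
Proof.
move=> /(subnorm_le v0) h /(subnorm_le v) h0.
rewrite dotDl dotNl; rewrite -(opprB v v0) dotNr in h.
by move: h h0; move: (dot p _) (dot p0 _) (c * _) (c * _) => ? ? ? ?; lra.
Qed.

(** The equality case of Cauchy-Schwarz: the squared distance of the two sides is |v|^2 (|p|^2 -
    c^2), which is at most 0. Written without division, it covers v = 0 and c = 0. *)
Lemma subnorm_dir v p : subnorm v p -> c *: v = enorm v *: p.
Proof.
move=> [pc pv]; apply/eqP; rewrite -subr_eq0; apply/eqP/dot_eq0/eqP.
rewrite eq_le dot_ge0 andbT !dotE (dotC v p) pv -!enorm_sqr.
have p0 := enorm_ge0 p; have : enorm p ^+ 2 <= c ^+ 2 by rewrite ler_pXn2r ?nnegrE.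
move=> /(ler_wpM2l (sqr_ge0 (enorm v))).
by move: (enorm v) (enorm p) => x y; nra.
Qed.

Lemma subnorm_norm v p : subnorm v p -> v != 0 -> enorm p = c.
Proof.
move=> pv v0; have /(congr1 (@enorm R n)) := subnorm_dir pv.
rewrite !enormZ !ger0_norm ?enorm_ge0// mulrC.
by move/mulfI => -> //; rewrite gt_eqF// enorm_gt0.
Qed.

(* The complementarity gap is of second order in p - p0. *)
Lemma subnorm_gap v v0 p p0 : subnorm v p -> subnorm v0 p0 ->
  enorm p = c -> enorm p0 = c ->
  c * (c * enorm v0 - dot p v0) = enorm v0 * enorm (p - p0) ^+ 2 / 2.
Proof.
move=> pv pv0 pc p0c; rewrite mulrBr -dotZr (subnorm_dir pv0) dotZr.
by rewrite enorm_sqr !dotE (dotC p0 p) -!enorm_sqr pc p0c; field.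
Qed.

End norm_subdifferential.

Lemma subr_split (R : realType) (n : nat) (a a0 g g0 : 'rV[R]_n) :
  a - a0 = (g - g0) + ((a - g) - (a0 - g0)).
Proof. by apply/rowP => i; rewrite !mxE; ring. Qed.

Section stationarity.
Variables (R : realType) (n : nat) (sigma c : R) (f : 'rV[R]_n -> \bar R) (q : 'rV[R]_n).
Hypothesis sigma_gt0 : 0 < sigma.
Hypothesis c_ge0 : 0 <= c.
Hypothesis f_gtNy : forall J, (-oo < f J)%E.
Hypothesis f_reg : regular_energy sigma f.

Let D := edom f.
Let u := fine \o f.
Implicit Types (x y v w H J p : 'rV[R]_n).

(* H lies in the subdifferential at J of u + c |. - q|. *)
Definition stationary H J : Prop := D J /\ subnorm c (J - q) (H - grad u J).

Lemma min_dom H J : (forall J', pinned_energy c f q H J <= pinned_energy c f q H J')%E -> D J.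
Proof.
have [[x Dx] _ _ _ _] := f_reg; move=> /(_ x).
rewrite (pinned_energyE _ _ f_gtNy _ Dx) /pinned_energy /D /edom /=.
by case: (f J) => [r _| |//]; [exact: ltry|rewrite addye// leye_eq].
Qed.

(** Only the smooth part is linearized. The norm is kept, and its convexity turns the variation
    along a short step into a subgradient inequality for every [v], however large. *)
Lemma min_stationary H J :
  (forall J', pinned_energy c f q H J <= pinned_energy c f q H J')%E -> stationary H J.
Proof.
move=> Jmin; have DJ := min_dom Jmin.
have [du _ _] := energy_C2 f_reg DJ; have [d' d'0 HD] := energy_open f_reg DJ.
set p := H - grad u J.
have sub v : dot p v <= c * (enorm (J - q + v) - enorm (J - q)).
  apply: (@ler_of_eps _ (enorm v)) => e e0.
  have [delta d0 Hd] := grad_approx du e0; rewrite -/u in Hd.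
  have [|t [t0 t1 _ td]] := @small_step _ _ v (Num.min delta d') 1 _ ltr01.
    by rewrite lt_min d0.
  move: td; rewrite lt_min => /andP[td td'].
  have xtv : J + t *: v - J = t *: v by rewrite addrC addKr.
  have Dy : D (J + t *: v) by apply: HD; rewrite xtv.
  have := Jmin (J + t *: v); rewrite !(pinned_energyE _ _ f_gtNy)// lee_fin -/u.
  have := Hd (J + t *: v); rewrite xtv => /(_ td).
  rewrite enormZ (ger0_norm (ltW t0)) dotZr dotDr dotZr ler_norml => /andP[_ up] mn.
  have nm : enorm (J + t *: v - q) <= (1 - t) * enorm (J - q) + t * enorm (J - q + v).
    have -> : J + t *: v - q = (1 - t) *: (J - q) + t *: (J - q + v).
      by apply/rowP => i; rewrite !mxE; ring.
    by rewrite (le_trans (enormD _ _))// !enormZ !ger0_norm ?subr_ge0 ?(ltW t0).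
  rewrite -(ler_pM2l t0) /p dotDl dotNl.
  by have := ler_wpM2l c_ge0 nm; lra.
(* The choice [v = p] bounds the multiplier; [v = - (J - q)] below gives the half of the
   complementarity identity that Cauchy-Schwarz does not. *)
have pc : enorm p <= c.
  have [->|p0] := eqVneq p 0; first by rewrite enorm0.
  rewrite -(ler_pM2r (enorm_gt0 p0)) -expr2 enorm_sqr (le_trans (sub p))//.
  by rewrite ler_wpM2l// lerBlDl enormD.
split => //; split => //; apply/eqP; rewrite eq_le; apply/andP; split.
  by rewrite (le_trans (cauchy_schwarz _ _))// ler_wpM2r// enorm_ge0.
have := sub (- (J - q)); rewrite subrr enorm0 dotNr sub0r mulrN lerN2.
by [].
Qed.

Section stationary_pair.
Variables (H H0 J J0 : 'rV[R]_n).
Hypotheses (sJ : stationary H J) (sJ0 : stationary H0 J0).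

Let distq x y : x - q - (y - q) = x - y.
Proof. by rewrite opprB addrA subrK. Qed.

Lemma stationary_mono : sigma * dot (J - J0) (J - J0) <= dot (H - H0) (J - J0).
Proof.
have [DJ pJ] := sJ; have [DJ0 pJ0] := sJ0.
have := energy_grad_mono sigma_gt0 f_gtNy f_reg DJ0 DJ; rewrite -/u => /le_trans; apply.
have := subnorm_mono pJ pJ0; rewrite distq.
by rewrite (subr_split H H0 (grad u J) (grad u J0)) (dotDl (grad u J - _)) lerDl.
Qed.

Lemma stationary_lipschitz : sigma * enorm (J - J0) <= enorm (H - H0).
Proof.
have [->|JJ0] := eqVneq J J0; first by rewrite subrr enorm0 mulr0 enorm_ge0.
have e0 : 0 < enorm (J - J0) by rewrite enorm_gt0// subr_eq0.
rewrite -(ler_pM2r e0) -mulrA -expr2 enorm_sqr (le_trans stationary_mono)//.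
exact: cauchy_schwarz.
Qed.

(** At a stationary pair this is the convex conjugate of u + c |. - q| at [H], with [J] attaining
    the supremum. *)
Definition conjugate_value H J := dot H J - u J - c * enorm (J - q).

(** [J0] is a competitor in the supremum that defines the conjugate at [H]; hence it is a
    subgradient of the conjugate at [H0]. *)
Lemma conjugate_lower :
  dot J0 (H - H0) <= conjugate_value H J - conjugate_value H0 J0.
Proof.
have [DJ pJ] := sJ; have [DJ0 pJ0] := sJ0.
have := energy_grad_le sigma_gt0 f_gtNy f_reg DJ DJ0; rewrite -/u => h.
have h0 : 0 <= sigma / 2 * dot (J0 - J) (J0 - J).
  by rewrite mulr_ge0 ?dot_ge0// divr_ge0// ltW.
have := subnorm_le (J0 - q) pJ; rewrite distq.
rewrite dotDl dotNl => h1.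
rewrite /conjugate_value [dot J0 _]dotDr dotNr !(dotC J0).
have : dot H (J0 - J) = dot H J0 - dot H J by rewrite dotDr dotNr.
move: h h0 h1.
by move: (dot (grad u J) _) (dot H (J0 - J)) (sigma / 2 * _) (c * _) (c * _) (u J) (u J0)
  (dot H J) (dot H J0) (dot H0 J0) => *; lra.
Qed.

End stationary_pair.

End stationarity.

(** * Local behaviour of the polarization *)

Section local_norm.
Variables (R : realType) (n : nat) (c : R).
Hypothesis c_ge0 : 0 <= c.
Implicit Types (v w p y : 'rV[R]_n).

Lemma norm_lipschitz v w : `|enorm v - enorm w| <= enorm (v - w).
Proof.
have := enormD (v - w) w; have := enormD (w - v) v.
by rewrite !subrK (enorm_distC w) ler_norml => ? ?; apply/andP; split; lra.
Qed.

(* The tangential part of p - p0 is absorbed by the curvature c / |v| of the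
   norm; its radial part is of second order. At c = 0 both sides vanish, as
   0^-1 = 0. *)
Lemma norm_curvature_bound v v0 p p0 y :
  subnorm c v p -> subnorm c v0 p0 -> v != 0 -> enorm p = c -> enorm p0 = c ->
  `|enorm v - enorm v0| <= enorm v ->
  dot (p - p0 - (c / enorm v) *: (v - v0 - (dot (v - v0) v / enorm v ^+ 2) *: v)) y
    - c / enorm v * (dot y y - dot y v ^+ 2 / enorm v ^+ 2)
  <= c^-1 * (enorm (v - v0) * enorm (p - p0) ^+ 2 / 4 +
             enorm y * enorm (p - p0) ^+ 2 / 2).
Proof.
move=> pv pv0 vN0 pc p0c vv0; have N_gt0 := enorm_gt0 vN0.
have [c0|cN0] := eqVneq c 0.
  have p_0 : p = 0 by apply: enorm_eq0; rewrite pc.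
  have p0_0 : p0 = 0 by apply: enorm_eq0; rewrite p0c.
  by rewrite p_0 p0_0 c0 !mul0r invr0 mul0r scale0r !subr0 dot0l.
have c_gt0 : 0 < c by rewrite lt_def cN0.
have dv w : dot v w = enorm v * dot p w / c.
  apply: (mulfI cN0); rewrite -(dotZl c) (subnorm_dir c_ge0 pv) dotZl; field.
  by rewrite cN0.
have dv0 w : dot v0 w = enorm v0 * dot p0 w / c.
  apply: (mulfI cN0); rewrite -(dotZl c) (subnorm_dir c_ge0 pv0) dotZl; field.
  by rewrite cN0.
have D2 : enorm (p - p0) ^+ 2 = 2 * (c ^+ 2 - dot p p0).
  by rewrite enorm_sqr !dotE (dotC p0 p) -!enorm_sqr pc p0c; ring.
set N := enorm v in N_gt0 dv vv0 *; set N0 := enorm v0 in dv0 vv0 *.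
set a := dot p y; set b := dot p0 y; set k := dot p p0 in D2 *.
set Y := dot y y; set s := N0 / N.
have k_le : 0 <= c ^+ 2 - k by have := sqr_ge0 (enorm (p - p0)); rewrite D2; lra.
(* The vector y - (a / c^2) p is the part of [y] orthogonal to [p]. This [lam] completes the square:
   after multiplication by c / N the cross term is exactly the tangential term, so that it is
   bounded by the curvature and a remainder in |p - p0|^2. *)
set lam := (1 - s) * N / (2 * c).
have := dot_ge0 (y - (a / c ^+ 2) *: p - lam *: (p - p0)).
have -> : dot (y - (a / c ^+ 2) *: p - lam *: (p - p0))
    (y - (a / c ^+ 2) *: p - lam *: (p - p0)) =
  (Y - a ^+ 2 / c ^+ 2) - 2 * lam * (a * k / c ^+ 2 - b) +
    lam ^+ 2 * (2 * (c ^+ 2 - k)).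
  rewrite !dotE !(dotC y) (dotC p0 p) -!(enorm_sqr p) -(enorm_sqr p0) pc p0c.
  by rewrite -/a -/b -/k -/Y; field.
(* As [v] and [v0] are multiples of [p] and [p0], only [a], [b], [k] and [s] remain. The last
   summand is the radial part, of second order since c^2 - k = |p - p0|^2 / 2. *)
have -> : dot (p - p0 - (c / N) *: (v - v0 - (dot (v - v0) v / N ^+ 2) *: v)) y =
    (1 - s) * (a * k / c ^+ 2 - b) + a * (1 - k / c ^+ 2).
  rewrite [dot (v - v0) v]dotC dv dotDr dotNr (dotC p v) dv -enorm_sqr pc (dotC p v0) dv0.
  rewrite !dotE !dv !dv0 (dotC p0 p) -/a -/b -/k -/s /s; field.
  by rewrite cN0 gt_eqF.
rewrite (dotC y v) dv -/a D2 => key.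
have ya : a <= enorm y * c by rewrite -pc mulrC cauchy_schwarz.
(* The hypothesis |N - N0| <= N enters here: it cancels one factor against the possibly small N. *)
have m1 : (N - N0) ^+ 2 / N <= enorm (v - v0).
  apply: le_trans (norm_lipschitz v v0); rewrite ler_pdivrMr//.
  by rewrite -(@real_normK _ (N - N0)) ?num_real// expr2 ler_wpM2l.
have {}key : (1 - s) * (a * k / c ^+ 2 - b) - c / N * (Y - a ^+ 2 / c ^+ 2) <=
    (N - N0) ^+ 2 / N * ((c ^+ 2 - k) / (2 * c)).
  have cN : 0 <= c / N by rewrite divr_ge0// ltW.
  have := mulr_ge0 cN key; rewrite /lam /s.
  set X := a * k / c ^+ 2 - b; set Z := Y - _.
  have -> : c / N * (Z - 2 * ((1 - N0 / N) * N / (2 * c)) * X +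
      ((1 - N0 / N) * N / (2 * c)) ^+ 2 * (2 * (c ^+ 2 - k))) =
    (N - N0) ^+ 2 / N * ((c ^+ 2 - k) / (2 * c)) - ((1 - N0 / N) * X - c / N * Z).
    by field; rewrite cN0 gt_eqF.
  by rewrite subr_ge0.
have -> : (N * a / c) ^+ 2 / N ^+ 2 = a ^+ 2 / c ^+ 2 by field; rewrite cN0 gt_eqF.
have h1 := ler_wpM2r (_ : 0 <= (c ^+ 2 - k) / (2 * c)) m1.
have h2 : a * (1 - k / c ^+ 2) <= c^-1 * (enorm y * (2 * (c ^+ 2 - k)) / 2).
  have -> : a * (1 - k / c ^+ 2) = a * ((c ^+ 2 - k) / c ^+ 2) by field.
  have -> : c^-1 * (enorm y * (2 * (c ^+ 2 - k)) / 2) =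
    enorm y * c * ((c ^+ 2 - k) / c ^+ 2) by field.
  by rewrite ler_wpM2r// divr_ge0// sqr_ge0.
have h3 : c^-1 * (enorm (v - v0) * (2 * (c ^+ 2 - k)) / 4) =
  enorm (v - v0) * ((c ^+ 2 - k) / (2 * c)) by field.
rewrite addrAC (mulrDr c^-1) h3 lerD//; apply: le_trans key (h1 _).
by rewrite divr_ge0// mulr_ge0// ltW.
Qed.

End local_norm.

(** Under conjugation the trapezoidal error of the energy changes sign; the nonsmooth part
    contributes half the difference of the two complementarity gaps. *)
Lemma trapezoid_identity (R : realType) (n : nat) (g g0 p p0 J J0 q : 'rV[R]_n) (a a0 : R) :
  dot (g + p) J - a - dot p (J - q) - (dot (g0 + p0) J0 - a0 - dot p0 (J0 - q)) -
    2^-1 * dot (J + J0) (g + p - (g0 + p0)) =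
  - (a - a0 - 2^-1 * dot (g0 + g) (J - J0)) -
    2^-1 * (dot p (J - q) - dot p0 (J - q) - (dot p0 (J0 - q) - dot p (J0 - q))).
Proof. by rewrite !dotE !(dotC J) !(dotC J0); field. Qed.

Section coercive_matrix.
Variables (R : realType) (n : nat) (sigma : R) (A : 'M[R]_n).
Hypothesis sigma_gt0 : 0 < sigma.
Hypothesis A_coercive : forall v : 'rV[R]_n, sigma * dot v v <= dot (v *m A^T) v.
Implicit Types (v w : 'rV[R]_n).

Lemma coercive_unitmx : A \in unitmx.
Proof.
rewrite -unitmx_tr -row_free_unit -kermx_eq0; apply/eqP/row_matrixP => i.
rewrite row0; set v := row i _.
have vA : v *m A^T = 0 by apply/sub_kermxP; exact: row_sub.
apply: dot_eq0; apply/eqP; rewrite eq_le dot_ge0 andbT -(ler_pM2l sigma_gt0) mulr0.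
by rewrite (le_trans (A_coercive v))// vA dot0l.
Qed.

Lemma mulmx_invK w : w *m (invmx A)^T *m A^T = w.
Proof. by rewrite -mulmxA -trmx_mul mulmxV ?coercive_unitmx// trmx1 mulmx1. Qed.

Lemma coercive_inv_le w : sigma * enorm (w *m (invmx A)^T) <= enorm w.
Proof.
set v := w *m _; have [->|v0] := eqVneq v 0; first by rewrite enorm0 mulr0 enorm_ge0.
rewrite -(ler_pM2r (enorm_gt0 v0)) -mulrA -expr2 enorm_sqr.
by rewrite (le_trans (A_coercive v))// /v mulmx_invK cauchy_schwarz.
Qed.

Lemma coercive_inv_ge0 w : 0 <= dot (w *m (invmx A)^T) w.
Proof.
set v := w *m _; rewrite -[X in dot v X]mulmx_invK -/v dotC.
by apply: le_trans (A_coercive v); rewrite mulr_ge0 ?dot_ge0// ltW.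
Qed.

End coercive_matrix.

Section local_analysis.
Variables (R : realType) (n : nat) (sigma c : R) (f : 'rV[R]_n -> \bar R) (q : 'rV[R]_n).
Hypothesis sigma_gt0 : 0 < sigma.
Hypothesis c_ge0 : 0 <= c.
Hypothesis f_gtNy : forall J, (-oo < f J)%E.
Hypothesis f_reg : regular_energy sigma f.

Let D := edom f.
Let u := fine \o f.
Let stationary := stationary c f q.
Implicit Types (x y v w H J p : 'rV[R]_n).

(** For J different from q, the Hessian of u + c |. - q|: its second term is c / |J - q| times the
    orthogonal projection along J - q. *)
Definition pinned_hess J : 'M[R]_n :=
  hess u J + (c / enorm (J - q)) *:
    (1%:M - (enorm (J - q) ^+ 2)^-1 *: ((J - q)^T *m (J - q))).

Lemma mulmx_pinned_hess v J : v *m (pinned_hess J)^T = v *m (hess u J)^T +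
  (c / enorm (J - q)) *: (v - (dot v (J - q) / enorm (J - q) ^+ 2) *: (J - q)).
Proof.
rewrite /pinned_hess linearD/= linearZ/= linearB/= linearZ/= trmx1 trmx_mul trmxK.
rewrite mulmxDr -!scalemxAr mulmxBr mulmx1 -scalemxAr mulmxA.
have -> : v *m (J - q)^T = (dot v (J - q))%:M.
  by apply/rowP => i; rewrite ord1 !mxE; apply: eq_bigr => j _; rewrite mxE.
by rewrite mul_scalar_mx scalerA [_^-1 * _]mulrC.
Qed.

(** Besides coercivity this retains the curvature of the norm, which later cancels against the same
    term in [norm_curvature_bound]. *)
Lemma pinned_hess_quadratic v J : D J ->
  sigma * dot v v + c / enorm (J - q) *
    (dot v v - dot v (J - q) ^+ 2 / enorm (J - q) ^+ 2) <= dot (v *m (pinned_hess J)^T) v.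
Proof.
move=> DJ; rewrite mulmx_pinned_hess dotDl lerD//.
  exact: (energy_hess_ge sigma_gt0 f_gtNy f_reg).
rewrite dotZl (dotDl v) dotNl dotZl (dotC (J - q) v).
rewrite ler_wpM2l ?divr_ge0 ?enorm_ge0// le_eqVlt; apply/orP; left; apply/eqP.
by rewrite expr2 mulrAC.
Qed.

Lemma pinned_hess_coercive v J : D J ->
  sigma * dot v v <= dot (v *m (pinned_hess J)^T) v.
Proof.
move=> DJ; apply: le_trans (pinned_hess_quadratic v DJ).
rewrite lerDl mulr_ge0 ?divr_ge0 ?enorm_ge0// subr_ge0.
have [->|JN0] := eqVneq (J - q) 0.
  by rewrite dot0r expr0n mul0r dot_ge0.
rewrite ler_pdivrMr ?exprn_gt0 ?enorm_gt0// -enorm_sqr -exprMn.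
rewrite -(@real_normK _ (dot _ _)) ?num_real//.
by rewrite ler_pXn2r ?nnegrE ?mulr_ge0 ?enorm_ge0// cauchy_schwarz_abs.
Qed.

Section at_point.
Variables (H0 J0 : 'rV[R]_n).
Hypothesis sJ0 : stationary H0 J0.
Let p0 := H0 - grad u J0.

(** If J0 differs from q, the Lipschitz bound keeps |J - J0| below |J0 - q| / 2, so J differs from q
    too. If |p0| < c, then J = q, because otherwise |p| = c, whereas p stays closer to p0 than c -
    |p0|. If J0 = q and |p0| = c, both alternatives can occur, and the last bound of the second one
    is an equality. The radii [d2] and [d3] serve the first two cases and default to 1 elsewhere. *)
Lemma stationary_dichotomy : exists K delta : R, [/\ 0 <= K, 0 < delta &
  forall H J, stationary H J -> enorm (H - H0) < delta ->
  [/\ D J, enorm (J - J0) <= enorm (H - H0) / sigma,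
      enorm (H - grad u J - p0) <= K * enorm (H - H0) &
      (J = q /\ J0 = q) \/
      [/\ J - q != 0, enorm (H - grad u J) = c, enorm p0 = c &
          `|enorm (J - q) - enorm (J0 - q)| <= enorm (J - q)]]].
Proof.
have [DJ0 pJ0] := sJ0; have [Kg [dg [Kg0 dg0 Hg]]] := energy_grad_lipschitz f_reg DJ0.
set K := 1 + Kg / sigma; have K0 : 0 < K by rewrite ltr_wpDr// divr_ge0// ltW.
have [d2 d20 H2] : exists2 d2 : R, 0 < d2 & J0 - q != 0 -> d2 <= sigma * (enorm (J0 - q) / 2).
  have [_|N0] := eqVneq (J0 - q) 0; first by exists 1.
  by exists (sigma * (enorm (J0 - q) / 2)) => //; rewrite mulr_gt0// divr_gt0// enorm_gt0.
have [d3 d30 H3] : exists2 d3 : R, 0 < d3 & enorm p0 < c -> K * d3 <= c - enorm p0.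
  have [lt|_] := ltP (enorm p0) c; last by exists 1.
  exists ((c - enorm p0) / K); first by rewrite divr_gt0// subr_gt0.
  by rewrite mulrC divfK// gt_eqF.
exists K, (Num.min (sigma * dg) (Num.min d2 d3)); split; first exact: ltW.
  by rewrite !lt_min d20 d30 mulr_gt0.
move=> H J sJ; rewrite !lt_min => /and3P[h1 h2 h3].
have lip := stationary_lipschitz sigma_gt0 f_gtNy f_reg sJ sJ0.
have JJ0 : enorm (J - J0) <= enorm (H - H0) / sigma by rewrite ler_pdivlMr// mulrC.
have [DJ pJ] := sJ.
have Jdg : enorm (J - J0) < dg.
  by apply: (le_lt_trans JJ0); rewrite ltr_pdivrMr// mulrC.
have [_ gl] := Hg _ Jdg; rewrite -/u in gl.
have pp : enorm (H - grad u J - p0) <= K * enorm (H - H0).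
  have -> : H - grad u J - p0 = (H - H0) - (grad u J - grad u J0).
    by apply/rowP => i; rewrite !mxE; ring.
  rewrite (le_trans (enormB _ _))// mulrDl mul1r lerD2l (le_trans gl)//.
  by rewrite -mulrA ler_wpM2l// mulrC.
split => //; have [J0q|J0q] := eqVneq (J0 - q) 0; last first.
  right; have := H2 J0q; set N0 := enorm (J0 - q) => N0d.
  have N0_gt0 : 0 < N0 := enorm_gt0 J0q.
  have JN : enorm (J - J0) <= N0 / 2.
    by rewrite (le_trans JJ0)// ler_pdivrMr// mulrC ltW// (lt_le_trans h2).
  have := norm_lipschitz (J - q) (J0 - q); rewrite opprB addrA subrK -/N0.
  move=> /le_trans/(_ JN) nl; have JqN : N0 / 2 <= enorm (J - q).
    by move: nl; rewrite ler_norml => /andP[+ _]; lra.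
  have Jq : J - q != 0.
    by apply/eqP => J0'; move: JqN; rewrite J0' enorm0; lra.
  by split => //; [exact: subnorm_norm pJ Jq|exact: subnorm_norm pJ0 J0q|exact: le_trans nl _].
have [Jq|Jq] := eqVneq (J - q) 0.
  by left; split; apply/eqP; rewrite -subr_eq0; apply/eqP.
right; have pc := subnorm_norm c_ge0 pJ Jq.
split; [by []|exact: pc| |by rewrite J0q enorm0 subr0 ger0_norm ?enorm_ge0].
apply/eqP; rewrite eq_le; case: pJ0 => -> _ /=; rewrite leNgt; apply/negP => lt.
have := H3 lt; have := norm_lipschitz (H - grad u J) p0; rewrite -/u pc.
rewrite ger0_norm; last by rewrite subr_ge0 ltW.
move=> nl k3.
have : K * enorm (H - H0) < K * d3 by rewrite ltr_pM2l.
by rewrite ltNge (le_trans k3 (le_trans nl pp)).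
Qed.

Lemma conjugate_trapezoid (e : R) : 0 < e -> exists2 delta : R, 0 < delta &
  forall H J, stationary H J -> enorm (H - H0) < delta ->
  `|conjugate_value c f q H J - conjugate_value c f q H0 J0 -
    2^-1 * dot (J + J0) (H - H0)| <= e * enorm (H - H0) ^+ 2.
Proof.
move=> e0; have [DJ0 pJ0] := sJ0.
have [K [d [K0 d0 Hd]]] := stationary_dichotomy.
have e'0 : 0 < e / 2 * sigma ^+ 2 by rewrite mulr_gt0 ?exprn_gt0// divr_gt0.
have [dt dt0 Ht] := energy_trapezoid f_reg DJ0 e'0; rewrite -/u in Ht.
(* Half of the gap is at most [B] |H - H0|^3, so the last entry of the radius makes it at most half
   of the tolerance. *)
set B := c^-1 * K ^+ 2 / (4 * sigma).
have B0 : 0 <= B by rewrite divr_ge0 ?mulr_ge0 ?sqr_ge0 ?invr_ge0// ltW.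
exists (Num.min d (Num.min (sigma * dt) (e / 2 / (B + 1)))).
  by rewrite !lt_min d0 mulr_gt0// !divr_gt0// ltr_wpDl.
move=> H J sJ; rewrite !lt_min => /and3P[h1 h2 h3].
have [DJ JJ0 pp dich] := Hd _ _ sJ h1; have [_ pJ] := sJ.
have Jdt : enorm (J - J0) < dt.
  by apply: (le_lt_trans JJ0); rewrite ltr_pdivrMr// mulrC.
have {}Ht := Ht _ Jdt.
set h := enorm (H - H0) in JJ0 pp h1 h2 h3 *; have hge : 0 <= h := enorm_ge0 _.
clearbody h.
have tb : e / 2 * sigma ^+ 2 * enorm (J - J0) ^+ 2 <= e / 2 * h ^+ 2.
  rewrite -mulrA -exprMn ler_wpM2l ?divr_ge0 ?(ltW e0)//.
  rewrite ler_pXn2r ?nnegrE ?mulr_ge0 ?enorm_ge0 ?(ltW sigma_gt0)//.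
  by move: JJ0; rewrite ler_pdivlMr// mulrC.
set p := H - grad u J in pp dich pJ.
set gap := (c * enorm (J - q) - dot p0 (J - q)) - (c * enorm (J0 - q) - dot p (J0 - q)).
have -> : conjugate_value c f q H J - conjugate_value c f q H0 J0 -
    2^-1 * dot (J + J0) (H - H0) =
  - (u J - u J0 - 2^-1 * dot (grad u J0 + grad u J) (J - J0)) - 2^-1 * gap.
  have pq : dot p (J - q) = c * enorm (J - q) by have [] := pJ.
  have p0q : dot p0 (J0 - q) = c * enorm (J0 - q) by have [] := pJ0.
  have HE : H = grad u J + p by rewrite /p addrC subrK.
  have H0E : H0 = grad u J0 + p0 by rewrite /p0 addrC subrK.
  rewrite /conjugate_value -/u -pq -p0q HE H0E -/p0 /gap -pq -p0q -/p0.
  exact: trapezoid_identity.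
have Bh : 0 <= 2 * (B * h ^+ 3) by rewrite mulr_ge0// mulr_ge0// exprn_ge0.
have gapB : `|gap| <= 2 * (B * h ^+ 3).
  case: dich => [[Jq J0q]|[Jq pc p0c _]].
    have -> : gap = 0 by rewrite /gap Jq J0q (subrr q) enorm0 !dot0r mulr0 !subr0.
    by rewrite normr0.
  have [c0|cN0] := eqVneq c 0.
    have p_0 : p = 0 by apply: enorm_eq0; rewrite pc.
    have p0_0 : p0 = 0 by apply: enorm_eq0; rewrite p0c.
    have -> : gap = 0 by rewrite /gap p_0 p0_0 !dot0l c0 !mul0r !subrr.
    by rewrite normr0.
  have c_gt0 : 0 < c by rewrite lt_def cN0.
  have g1 : c * (c * enorm (J0 - q) - dot p (J0 - q)) =
      enorm (J0 - q) * enorm (p - p0) ^+ 2 / 2 by exact: (subnorm_gap c_ge0 pJ pJ0 pc p0c).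
  have g2 : c * (c * enorm (J - q) - dot p0 (J - q)) =
      enorm (J - q) * enorm (p - p0) ^+ 2 / 2.
    by rewrite (enorm_distC p); exact: (subnorm_gap c_ge0 pJ0 pJ p0c pc).
  have -> : gap = c^-1 * ((enorm (J - q) - enorm (J0 - q)) * (enorm (p - p0) ^+ 2 / 2)).
    by apply: (mulfI cN0); rewrite (mulVKf cN0) /gap mulrBr g1 g2; ring.
  have lip := norm_lipschitz (J - q) (J0 - q); rewrite opprB addrA subrK in lip.
  have sq0 : 0 <= enorm (p - p0) ^+ 2 / 2 by rewrite divr_ge0// sqr_ge0.
  rewrite normrM (ger0_norm (_ : 0 <= c^-1)) ?invr_ge0// normrM (ger0_norm sq0).
  have -> : 2 * (B * h ^+ 3) = c^-1 * (h / sigma * ((K * h) ^+ 2 / 2)).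
    by rewrite /B; field; rewrite gt_eqF// cN0.
  rewrite ler_pM2l ?invr_gt0// ler_pM ?(le_trans lip)// ?mulr_ge0 ?sqr_ge0 ?invr_ge0//.
  rewrite ler_pM2r ?invr_gt0// ler_pXn2r ?nnegrE ?enorm_ge0 ?mulr_ge0//.
rewrite (le_trans (ler_normB _ _))// normrN (splitr e) mulrDl lerD ?(le_trans Ht)//.
rewrite normrM ger0_norm ?invr_ge0// ler_pdivrMl//.
rewrite (le_trans gapB)// ler_wpM2l// exprS mulrA ler_wpM2r ?sqr_ge0//.
move: h3; rewrite ltr_pdivlMr ?ltr_wpDl//; move=> /ltW; apply: le_trans.
by rewrite mulrDr mulr1 mulrC lerDl.
Qed.

End at_point.
End local_analysis.

(** The hypothesis says (a - b) (a + b / 2) <= 0. It closes the semismoothness estimate, with [a]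
    the residual and [b] its target bound. *)
Lemma ler_of_quadratic (R : realType) (sigma a b : R) : 0 < sigma -> 0 <= b ->
  sigma * a ^+ 2 <= sigma * (a * b / 2 + b ^+ 2 / 2) -> a <= b.
Proof.
move=> s0 b0; rewrite ler_pM2l// => h; rewrite leNgt; apply/negP => ba; nra.
Qed.

Section semismoothness.
Variables (R : realType) (n : nat) (sigma c : R) (f : 'rV[R]_n -> \bar R) (q : 'rV[R]_n).
Hypothesis sigma_gt0 : 0 < sigma.
Hypothesis c_ge0 : 0 <= c.
Hypothesis f_gtNy : forall J, (-oo < f J)%E.
Hypothesis f_reg : regular_energy sigma f.

Let D := edom f.
Let u := fine \o f.
Let stationary := stationary c f q.
Let pinned_hess := pinned_hess c f q.
Implicit Types (x y v w H J p : 'rV[R]_n).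

Definition polarization_jacobian J : 'M[R]_n :=
  if J == q then 0 else invmx (pinned_hess J).

Lemma polarization_jacobian_ge0 J w : D J ->
  0 <= dot (w *m (polarization_jacobian J)^T) w.
Proof.
move=> DJ; rewrite /polarization_jacobian; case: ifP => _.
  by rewrite trmx0 mulmx0 dot0l.
apply: coercive_inv_ge0 sigma_gt0 _ w => v.
exact: (pinned_hess_coercive q sigma_gt0 c_ge0 f_gtNy f_reg v DJ).
Qed.

Lemma polarization_jacobian_le J w : D J ->
  enorm (w *m (polarization_jacobian J)^T) <= enorm w / sigma.
Proof.
move=> DJ; rewrite /polarization_jacobian; case: ifP => _.
  by rewrite trmx0 mulmx0 enorm0 divr_ge0 ?enorm_ge0// ltW.
rewrite ler_pdivlMr// mulrC; apply: coercive_inv_le => // v.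
exact: (pinned_hess_coercive q sigma_gt0 c_ge0 f_gtNy f_reg v DJ).
Qed.

(** An energy argument for the residual [y], since the pinned Hessian [A] at [J] is unbounded near
    the kink. Applying [A] to [y] leaves the linearization error [r1] of the gradient and the
    linearization error of the multiplier. Tested with [y], the latter is bounded by the curvature
    of the norm in direction [y] and a small remainder, and that curvature is available on the
    left. *)
Lemma polarization_semismooth H0 J0 (e : R) : stationary H0 J0 -> 0 < e ->
  exists2 delta : R, 0 < delta &
  forall H J, stationary H J -> enorm (H - H0) < delta ->
  enorm ((H - H0) *m (polarization_jacobian J)^T - (J - J0)) <= e * enorm (H - H0).
Proof.
move=> sJ0 e0; have [DJ0 pJ0] := sJ0; set p0 := H0 - _ in pJ0.
have [K [d [K0 d0 Hd]]] := stationary_dichotomy sigma_gt0 c_ge0 f_gtNy f_reg sJ0.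
have [_ dg ch] := energy_C2 f_reg DJ0.
(* Two Hessian errors of this size add up to [r1]. With [h] = |H - H0|, the remainder is at most B
   h^3 + C h^2 |y|; the radii make B h <= e^2 sigma / 2 and C h <= e sigma / 4. The three
   contributions sum up to the right-hand side of [ler_of_quadratic] with [b = e * h]. *)
have eta0 : 0 < e * sigma ^+ 2 / 8 by rewrite divr_gt0// mulr_gt0// exprn_gt0.
have [d1 d10 H1] := hess_approx dg eta0.
have [d2 d20 H2] := hess_continuous_approx ch eta0.
rewrite -/u in H1 H2.
set B := c^-1 * K ^+ 2 / (4 * sigma); set C := c^-1 * K ^+ 2 / 2.
have B0 : 0 <= B by rewrite divr_ge0 ?mulr_ge0 ?sqr_ge0 ?invr_ge0// ltW.
have C0 : 0 <= C by rewrite divr_ge0 ?mulr_ge0 ?sqr_ge0 ?invr_ge0.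
exists (Num.min (Num.min d (Num.min (sigma * d1) (sigma * d2)))
  (Num.min (e * sigma / 4 / (C + 1)) (e ^+ 2 * sigma / 2 / (B + 1)))).
  rewrite !lt_min d0 (mulr_gt0 sigma_gt0 d10) (mulr_gt0 sigma_gt0 d20) /=.
  by apply/andP; split; rewrite divr_gt0 ?ltr_wpDl// divr_gt0// mulr_gt0// exprn_gt0.
move=> H J sJ; rewrite !lt_min => /andP[/and3P[h1 h2 h3] /andP[h4 h5]].
have [DJ JJ0 pp dich] := Hd _ _ sJ h1; have [_ pJ] := sJ.
have Jd t : enorm (H - H0) < sigma * t -> enorm (J - J0) < t.
  by move=> ht; apply: (le_lt_trans JJ0); rewrite ltr_pdivrMr// mulrC.
have {}H1 := H1 _ (Jd _ h2); have {}H2 := H2 _ (Jd _ h3) (J - J0).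
rewrite /polarization_jacobian.
case: dich => [[Jq J0q]|[Jq pc p0c Jn]].
  rewrite Jq eqxx trmx0 mulmx0 J0q subrr subr0 enorm0.
  by rewrite mulr_ge0 ?enorm_ge0// ltW.
have -> : (J == q) = false by rewrite -subr_eq0; exact: negbTE.
set A := pinned_hess J; set p := H - grad u J in pp pc pJ.
set y := _ - (J - J0).
have Aco v : sigma * dot v v <= dot (v *m A^T) v.
  exact: (pinned_hess_coercive q sigma_gt0 c_ge0 f_gtNy f_reg v DJ).
have yA : y *m A^T = (H - H0) - (J - J0) *m A^T.
  by rewrite /y mulmxBl (mulmx_invK sigma_gt0 Aco).
have Jqq : J - q - (J0 - q) = J - J0 by rewrite opprB addrA subrK.
set r1 := grad u J - grad u J0 - (J - J0) *m (hess u J)^T.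
have yE : y *m A^T = r1 + (p - p0 - (c / enorm (J - q)) *: (J - q - (J0 - q) -
    (dot (J - q - (J0 - q)) (J - q) / enorm (J - q) ^+ 2) *: (J - q))).
  rewrite yA /A /pinned_hess mulmx_pinned_hess -/u Jqq (subr_split H H0 (grad u J) (grad u J0)).
  rewrite -/p -[H0 - grad u J0]/p0 /r1.
  move: (grad u J - grad u J0) ((J - J0) *m _) (p - p0) ((c / _) *: _) => r2 r3 r4 r5.
  by rewrite opprD addrACA.
have r1B : enorm r1 <= e * sigma ^+ 2 / 4 * enorm (J - J0).
  have -> : r1 = (grad u J - grad u J0 - (J - J0) *m (hess u J0)^T) -
     ((J - J0) *m (hess u J)^T - (J - J0) *m (hess u J0)^T).
    have sub3 (a b b' : 'rV[R]_n) : a - b = a - b' - (b - b') by rewrite opprB addrA subrK.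
    exact: sub3.
  rewrite (le_trans (enormB _ _))//.
  have -> : e * sigma ^+ 2 / 4 = e * sigma ^+ 2 / 8 + e * sigma ^+ 2 / 8 by field.
  by rewrite mulrDl lerD.
have quad := pinned_hess_quadratic q sigma_gt0 c_ge0 f_gtNy f_reg y DJ.
have curv := norm_curvature_bound c_ge0 y pJ pJ0 Jq pc p0c Jn.
rewrite -/pinned_hess -/A yE dotDl Jqq in quad; rewrite Jqq in curv.
have r1y := cauchy_schwarz r1 y.
rewrite -(enorm_sqr y) -lerBrDr in quad; rewrite -(enorm_sqr y) in curv.
have {}quad : sigma * enorm y ^+ 2 <= dot r1 y +
    c^-1 * (enorm (J - J0) * enorm (p - p0) ^+ 2 / 4 + enorm y * enorm (p - p0) ^+ 2 / 2).
  by apply: (le_trans quad); rewrite -addrA lerD2l.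
apply: (ler_of_quadratic sigma_gt0); first by rewrite mulr_ge0 ?enorm_ge0// ltW.
apply: (le_trans quad).
have j0 := enorm_ge0 (J - J0); have a0 := enorm_ge0 y.
have t0 := enorm_ge0 (p - p0); have hh0 := enorm_ge0 (H - H0).
have {r1y}r1y : dot r1 y <= e * sigma ^+ 2 / 4 * enorm (J - J0) * enorm y.
  by apply: (le_trans r1y); rewrite ler_wpM2r.
have {r1y}r1y : dot r1 y <= enorm y * (e * enorm (H - H0)) * sigma / 4.
  apply: (le_trans r1y).
  have -> : enorm y * (e * enorm (H - H0)) * sigma / 4 =
      e * sigma ^+ 2 / 4 * (enorm (H - H0) / sigma) * enorm y.
    by field; rewrite gt_eqF.
  by rewrite ler_wpM2r// ler_wpM2l// divr_ge0// mulr_ge0 ?exprn_ge0 ?ltW.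
have t2 : enorm (p - p0) ^+ 2 <= K ^+ 2 * enorm (H - H0) ^+ 2.
  by rewrite -exprMn ler_pXn2r ?nnegrE ?mulr_ge0.
have jt : enorm (J - J0) * enorm (p - p0) ^+ 2 <=
    enorm (H - H0) / sigma * (K ^+ 2 * enorm (H - H0) ^+ 2).
  by rewrite ler_pM ?sqr_ge0.
have yt : enorm y * enorm (p - p0) ^+ 2 <= enorm y * (K ^+ 2 * enorm (H - H0) ^+ 2).
  by rewrite ler_wpM2l.
have c1 : 0 <= c^-1 by rewrite invr_ge0.
move: h4 h5; rewrite ltr_pdivlMr ?ltr_wpDl// => h4; rewrite ltr_pdivlMr ?ltr_wpDl// => h5.
have rem : c^-1 * (enorm (J - J0) * enorm (p - p0) ^+ 2 / 4 +
    enorm y * enorm (p - p0) ^+ 2 / 2) <=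
    B * enorm (H - H0) * enorm (H - H0) ^+ 2 + C * enorm (H - H0) * (enorm y * enorm (H - H0)).
  have -> : B * enorm (H - H0) * enorm (H - H0) ^+ 2 +
      C * enorm (H - H0) * (enorm y * enorm (H - H0)) =
    c^-1 * (enorm (H - H0) / sigma * (K ^+ 2 * enorm (H - H0) ^+ 2) / 4 +
      enorm y * (K ^+ 2 * enorm (H - H0) ^+ 2) / 2).
    rewrite /B /C; move: (c^-1) (enorm _) (enorm _) => c' a' h'.
    by field; rewrite gt_eqF.
  by rewrite ler_wpM2l// lerD// ler_pM2r.
apply: (le_trans (lerD r1y rem)).
move: h4 h5 a0 hh0; move: (enorm y) (enorm (H - H0)) => a h h4 h5 a0 hh0.
have BB : B * h * h ^+ 2 <= e ^+ 2 * sigma / 2 * h ^+ 2.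
  by rewrite ler_wpM2r ?sqr_ge0// (le_trans _ (ltW h5))// mulrC ler_wpM2l// lerDl.
have CC : C * h * (a * h) <= e * sigma / 4 * (a * h).
  by rewrite ler_wpM2r ?mulr_ge0// (le_trans _ (ltW h4))// mulrC ler_wpM2l// lerDl.
have -> : sigma * (a * (e * h) / 2 + (e * h) ^+ 2 / 2) =
  a * (e * h) * sigma / 4 + (e ^+ 2 * sigma / 2 * h ^+ 2 + e * sigma / 4 * (a * h)).
  by field.
by rewrite lerD2l lerD.
Qed.

End semismoothness.

(** * The co-energy density *)

Lemma dot_basis (R : realType) (n : nat) (v : 'rV[R]_n) (i : 'I_n) :
  dot v (basis_row R i) = v ord0 i.
Proof.
rewrite /dot (bigD1 i)//= big1 => [|j ji]; rewrite /basis_row !mxE ?eqxx/=.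
  by rewrite mulr1 addr0.
by rewrite (negbTE ji) mulr0.
Qed.

Section coenergy_theory.
Variables (R : realType) (d : nat) (M : model R d) (sigma : R) (x : 'rV[R]_d).
Hypothesis sigma_gt0 : 0 < sigma.
Hypothesis mu0_gt0 : 0 < mu0 M.
Hypothesis chi_ge0 : 0 <= chi M x.
Hypothesis U_gtNy : forall J, (-oo < U M x J)%E.
Hypothesis U_reg : regular_energy sigma (U M x).
Implicit Types (H J v : 'rV[R]_d).

Let phi := conjugate_value (chi M x) (U M x) (Jp M x).
Let pol := polarization M x.
Let mu := mu0 M.

(** The 2 comes from [coenergy_upper]: the remainder of the conjugate is estimated by its
    subgradient inequality at the other endpoint, which gives 1 / sigma as coefficient of |H -
    H0|^2. *)
Definition lipschitz_constant (s : R) := mu0 M + 2 / s.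
Let L := lipschitz_constant sigma.

Definition induction H := mu0 M *: H + polarization M x H.
Let B := induction.

(** [polarization] is selected by [get], so its minimality amounts to the existence of a
    minimizer. *)
Lemma polarization_min H J : (inner_energy M x H (pol H) <= inner_energy M x H J)%E.
Proof.
have [J0 J0P] := pinned_energy_min (Jp M x) sigma_gt0 chi_ge0 U_gtNy U_reg H.
exact: (@getPex _ [set K | forall J', (inner_energy M x H K <= inner_energy M x H J')%E]
  (ex_intro _ J0 J0P) J).
Qed.

Lemma polarization_stationary H : stationary (chi M x) (U M x) (Jp M x) H (pol H).
Proof.
apply: (min_stationary chi_ge0 U_gtNy U_reg) => J.
exact: polarization_min.
Qed.

Lemma coenergyE H : coenergy M x H = mu / 2 * dot H H + phi H (pol H).
Proof.
rewrite /coenergy enorm_sqr; congr (_ + _).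
have [DJ _] := polarization_stationary H.
have -> : ereal_inf (range (inner_energy M x H)) = inner_energy M x H (pol H).
  apply/eqP; rewrite eq_le; apply/andP; split.
    by apply: ereal_inf_lbound; exists (pol H).
  by apply: le_ereal_inf_tmp => _ [J _ <-]; exact: polarization_min.
rewrite -[inner_energy M x H _]/(pinned_energy (chi M x) (U M x) (Jp M x) H (pol H)).
by rewrite (pinned_energyE (chi M x) (Jp M x) U_gtNy H DJ) /phi /conjugate_value /=; ring.
Qed.

Let phi_lower H H0 : dot (pol H0) (H - H0) <= phi H (pol H) - phi H0 (pol H0).
Proof.
exact: (conjugate_lower sigma_gt0 U_gtNy U_reg (polarization_stationary H)
  (polarization_stationary H0)).
Qed.

Let pol_lip H H0 : enorm (pol H - pol H0) <= enorm (H - H0) / sigma.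
Proof.
rewrite ler_pdivlMr// mulrC.
exact: (stationary_lipschitz sigma_gt0 U_gtNy U_reg (polarization_stationary H)
  (polarization_stationary H0)).
Qed.

Let coenergy_identity H H0 (a a0 : R) :
  mu / 2 * dot H H + a - (mu / 2 * dot H0 H0 + a0) - dot (B H0) (H - H0) =
  mu / 2 * dot (H - H0) (H - H0) + (a - a0 - dot (pol H0) (H - H0)).
Proof.
rewrite /B /induction -/mu -/pol; move: (pol H0) => J0.
by rewrite !dotE !(dotC J0) (dotC H0 H); field.
Qed.

Lemma coenergy_lower H H0 :
  mu / 2 * dot (H - H0) (H - H0) <=
  coenergy M x H - coenergy M x H0 - dot (B H0) (H - H0).
Proof.
rewrite !coenergyE -subr_ge0 coenergy_identity addrAC subrr add0r subr_ge0.
exact: phi_lower.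
Qed.

Lemma coenergy_upper H H0 :
  coenergy M x H - coenergy M x H0 - dot (B H0) (H - H0) <=
  L / 2 * dot (H - H0) (H - H0).
Proof.
rewrite !coenergyE coenergy_identity /L /lipschitz_constant.
have -> : (mu0 M + 2 / sigma) / 2 = mu / 2 + sigma^-1.
  by rewrite /mu; field; rewrite gt_eqF.
rewrite mulrDl lerD2l.
have := phi_lower H0 H; rewrite -(opprB H H0) dotNr -(opprB (phi H _)) lerN2 => up.
have -> : dot (pol H0) (H - H0) = dot (pol H) (H - H0) - dot (pol H - pol H0) (H - H0).
  by rewrite (dotDl (pol H)) dotNl subKr.
have lip : dot (pol H - pol H0) (H - H0) <= sigma^-1 * dot (H - H0) (H - H0).
  rewrite (le_trans (cauchy_schwarz _ _))// -enorm_sqr expr2 mulrA.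
  by rewrite ler_wpM2r ?enorm_ge0// mulrC pol_lip.
by rewrite lerBlDr (le_trans up)// -lerBlDr subKr.
Qed.

Lemma coenergy_diff_bound H H0 :
  `|coenergy M x H - coenergy M x H0 - dot (B H0) (H - H0)| <=
  L / 2 * dot (H - H0) (H - H0).
Proof.
rewrite ger0_norm ?coenergy_upper// (le_trans _ (coenergy_lower _ _))//.
by rewrite mulr_ge0 ?dot_ge0// divr_ge0// ltW.
Qed.

Lemma grad_coenergy H : grad (coenergy M x) H = B H.
Proof.
apply/rowP => i; rewrite mxE.
apply: (derive_of_quadratic_bound (C := L / 2)) => h.
have := coenergy_diff_bound (h *: basis_row R i + H) H; rewrite addrK.
rewrite dotZr dotZl dotZr.
rewrite !dot_basis [basis_row R i _ _]mxE !eqxx mulr1.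
by rewrite expr2.
Qed.

Lemma newton_matrixE H : newton_matrix M x H =
  (mu0 M)%:M + polarization_jacobian (chi M x) (U M x) (Jp M x) (pol H).
Proof.
rewrite /newton_matrix /polarization_jacobian -/pol; case: ifP => _ //.
by rewrite addr0.
Qed.

Lemma mulmx_newton H v : v *m (newton_matrix M x H)^T =
  mu *: v + v *m (polarization_jacobian (chi M x) (U M x) (Jp M x) (pol H))^T.
Proof. by rewrite newton_matrixE linearD/= tr_scalar_mx mulmxDr mul_mx_scalar. Qed.

Lemma newton_coercive H v : mu * dot v v <= dot (v *m (newton_matrix M x H)^T) v.
Proof.
rewrite mulmx_newton dotDl dotZl lerDl.
apply: (polarization_jacobian_ge0 _ sigma_gt0 chi_ge0 U_gtNy U_reg).
by have [] := polarization_stationary H.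
Qed.

Lemma newton_bounded H v : enorm (v *m (newton_matrix M x H)^T) <= L * enorm v.
Proof.
rewrite mulmx_newton (le_trans (enormD _ _))// enormZ (ger0_norm (ltW mu0_gt0)).
rewrite /L /lipschitz_constant mulrDl lerD2l.
have [DJ _] := polarization_stationary H.
rewrite (le_trans (polarization_jacobian_le _ sigma_gt0 chi_ge0 U_gtNy U_reg _ DJ))//.
rewrite mulrC ler_wpM2r ?enorm_ge0// ler_peMl ?invr_ge0 ?(ltW sigma_gt0)//.
by rewrite ler1n.
Qed.

Lemma induction_semismooth H0 (e : R) : 0 < e -> exists2 delta : R, 0 < delta &
  forall H, enorm (H - H0) < delta ->
  enorm ((H - H0) *m (newton_matrix M x H)^T - (B H - B H0)) <= e * enorm (H - H0).
Proof.
move=> e0; have sJ0 := polarization_stationary H0.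
have [delta d0 Hd] := polarization_semismooth sigma_gt0 chi_ge0 U_gtNy U_reg sJ0 e0.
exists delta => // H HH0; apply: le_trans (Hd _ _ (polarization_stationary H) HH0).
rewrite mulmx_newton /B /induction -/mu -/pol le_eqVlt; apply/orP; left; apply/eqP.
by congr enorm; apply/rowP => i; rewrite !mxE; ring.
Qed.

Lemma coenergy_trapezoid H0 (e : R) : 0 < e -> exists2 delta : R, 0 < delta &
  forall H, enorm (H - H0) < delta ->
  `|coenergy M x H - coenergy M x H0 - 2^-1 * dot (B H + B H0) (H - H0)|
    <= e * enorm (H - H0) ^+ 2.
Proof.
move=> e0; have sJ0 := polarization_stationary H0.
have [delta d0 Hd] := conjugate_trapezoid sigma_gt0 chi_ge0 U_gtNy U_reg sJ0 e0.
exists delta => // H HH0; apply: le_trans (Hd _ _ (polarization_stationary H) HH0).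
rewrite !coenergyE -/phi /B /induction -/mu -/pol.
move: (pol H) (pol H0) (phi H _) (phi H0 _) => J J0 a a0.
rewrite le_eqVlt; apply/orP; left; apply/eqP; congr (`|_|).
by rewrite !dotE !(dotC J) !(dotC J0) (dotC H0 H); field.
Qed.

End coenergy_theory.

(** * Abstract Newton method with Armijo backtracking *)

Lemma dot_mulmx (R : realType) (m : nat) (u v : 'rV[R]_m) : dot u v = (u *m v^T) ord0 ord0.
Proof. by rewrite mxE; apply: eq_bigr => i _; rewrite mxE. Qed.

(** * Solvability of the linear systems *)

Section galerkin.
Variables (R : realType) (m : nat) (G : set 'rV[R]_m) (K : 'M[R]_m) (mu : R).
Hypothesis G0 : G 0.
Hypothesis G_lin : forall (a : R) u v, G u -> G v -> G (u + a *: v).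
Hypothesis mu_gt0 : 0 < mu.
Hypothesis K_coercive : forall u : 'rV[R]_m, mu * dot u u <= dot (u *m K) u.

Let G_mulmx k (A : 'M[R]_(k, m)) (x : 'rV[R]_k) :
  (forall i, G (row i A)) -> G (x *m A).
Proof.
move=> GA; rewrite mulmx_sum_row.
elim/big_ind : _ => // [u v Gu Gv|i _]; first by rewrite -[v]scale1r; exact: G_lin.
by rewrite -[_ *: _]add0r; exact: G_lin.
Qed.

(** Choose rows from [G] of maximal rank: a vector of [G] outside their span would raise the rank.
    This gives a basis for a subspace known only through a predicate. *)
Lemma subspace_row_base : exists r (B : 'M[R]_(r, m)),
  [/\ row_free B, forall i, G (row i B) & forall g, G g -> (g <= B)%MS].
Proof.
pose P r := `[< exists k (A : 'M[R]_(k, m)), (forall i, G (row i A)) /\ \rank A = r >].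
have exP : exists r, P r.
  exists 0%N; apply/asboolP; exists 0%N, 0; split; last by rewrite mxrank0.
  by move=> [].
have boundP r : P r -> (r <= m)%N.
  by move=> /asboolP[k [A [_ <-]]]; exact: rank_leq_col.
case: (ex_maxnP exP boundP) => r /asboolP[k [A [GA rA]]] rmax.
exists _, (row_base A); split; first exact: row_base_free.
  move=> i; have /submxP[C ->] : (row_base A <= A)%MS by rewrite eq_row_base.
  by rewrite row_mul; exact: G_mulmx.
move=> g Gg; rewrite eq_row_base.
have sA : (A <= A + g)%MS := addsmxSl A g.
have := mxrank_leqif_sup sA => /leqifP.
case: ifP => [+ _|_]; first by apply: submx_trans; exact: addsmxSr.
rewrite rA addsmxE ltnNge => /negP[]; apply: rmax; apply/asboolP.
exists (k + 1)%N, (col_mx A g); split => // i; case: (split_ordP i) => j ->.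
  by rewrite rowKu.
by rewrite rowKd (ord1 j) row_id.
Qed.

(** In a basis the system matrix is [B *m K *m B^T], and coercivity makes its kernel trivial. *)
Lemma galerkin (b : 'rV[R]_m) :
  exists2 g, G g & forall v, G v -> dot (g *m K) v = dot b v.
Proof.
have [r [B [fB GB spanB]]] := subspace_row_base.
pose A := B *m K *m B^T.
have uA : A \in unitmx.
  rewrite -row_free_unit -kermx_eq0; apply/eqP/row_matrixP => i.
  rewrite row0; set y := row i _.
  have yA : y *m A = 0 by apply/sub_kermxP; exact: row_sub.
  have yB : y *m B = 0.
    apply: dot_eq0; apply/eqP; rewrite eq_le dot_ge0 andbT -(ler_pM2l mu_gt0) mulr0.
    rewrite (le_trans (K_coercive _))// dot_mulmx trmx_mul.
    have -> : y *m B *m K *m (B^T *m y^T) = y *m A *m y^T by rewrite /A !mulmxA.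
    by rewrite yA mul0mx mxE.
  by apply: (row_free_inj fB); rewrite yB mul0mx.
exists (b *m B^T *m invmx A *m B); first exact: G_mulmx.
move=> v /spanB/submxP[z ->].
rewrite !dot_mulmx trmx_mul; congr (fun_of_matrix _ _ _).
have -> : b *m B^T *m invmx A *m B *m K *m (B^T *m z^T) =
  b *m B^T *m invmx A *m (B *m K *m B^T) *m z^T by rewrite !mulmxA.
by rewrite -/A mulmxKV// mulmxA.
Qed.

End galerkin.

(** Here [w], [w'], [w0] are the co-energies before the step, after it and at the solution, [y] is
    the size of the step and [a] minus the predicted slope. The errors are at most L e y^2, 4 L e
    y^2 and L e y^2, from the distance after the step, the trapezoidal rule and [b]; their sum
    explains the 6. What remains is the decrease a / 2, and the surplus over [sigmaA * a] pays for
    the errors. *)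
Lemma full_step_real (R : realType) (L e mu sigmaA y a b w w' w0 : R) :
  0 < L -> 0 < e -> e <= 1 / 2 -> sigmaA < 1 / 2 ->
  6 * (L * e) <= (1 / 2 - sigmaA) * mu -> 0 <= y ->
  w' - w0 <= L / 2 * (2 * e * y) ^+ 2 ->
  `|w - w0 + 2^-1 * (b - a)| <= L * e * (2 * y) ^+ 2 ->
  b <= L * y * (2 * e * y) -> mu * y ^+ 2 <= a -> w' <= w - sigmaA * a.
Proof.
move=> L0 e0 e2 sA eL y0 h1; rewrite ler_norml => /andP[h2 _] h3 h4.
have y2 := sqr_ge0 y.
have k1 := ler_wpM2r y2 eL.
have k2 : (1 / 2 - sigmaA) * (mu * y ^+ 2) <= (1 / 2 - sigmaA) * a.
  by rewrite ler_wpM2l// subr_ge0 ltW.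
have k3 : L * y ^+ 2 * e * e <= L * y ^+ 2 * e * (1 / 2).
  by rewrite ler_wpM2l// mulr_ge0 ?(ltW e0)// mulr_ge0// ltW.
by move: h1 h2 h3 k1 k2 k3; clear; rewrite !exprMn !expr2; lra.
Qed.

Section newton_armijo.
Variables (R : realType) (V : lmodType R) (S : set V) (m : nat).
Variables (E : V -> 'rV[R]_m) (W : V -> R) (B : V -> 'rV[R]_m) (K : V -> 'M[R]_m).
Variables (mu L sigmaA rho : R).
Hypothesis S_lin : forall (a : R) u v, S u -> S v -> S (u + a *: v).
Hypothesis E_lin : forall (a : R) u v, S u -> S v -> E (u + a *: v) = E u + a *: E v.
Hypothesis mu_gt0 : 0 < mu.
Hypothesis muL : mu <= L.
Hypothesis sigmaA_range : 0 < sigmaA < 1 / 2.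
Hypothesis rho_range : 0 < rho < 1.
(** The sign of the linear term reflects that the field is the source minus the gradient: the slope
    of [W] at [u] along [v] is [- dot (B u) (E v)]. *)
Hypothesis W_lower : forall u v, S u -> S v ->
  mu / 2 * dot (E v) (E v) <= W (u + v) - W u + dot (B u) (E v).
Hypothesis W_upper : forall u v, S u -> S v ->
  W (u + v) - W u + dot (B u) (E v) <= L / 2 * dot (E v) (E v).
Hypothesis K_coercive : forall u x, S u -> mu * dot x x <= dot (x *m K u) x.
Hypothesis K_bounded : forall u x, S u -> enorm (x *m K u) <= L * enorm x.

Variable s : V.
Hypothesis Ss : S s.
Hypothesis s_sol : forall v, S v -> dot (B s) (E v) = 0.

Let L_gt0 : 0 < L. Proof. exact: lt_le_trans muL. Qed.

Let S_sub u v : S u -> S v -> S (u - v).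
Proof. by move=> Su Sv; rewrite -scaleN1r; exact: S_lin. Qed.

Let E_sub u v : S u -> S v -> E (u - v) = E u - E v.
Proof. by move=> Su Sv; rewrite -scaleN1r E_lin// scaleN1r. Qed.

Let S_add u v : S u -> S v -> S (u + v).
Proof. by move=> Su Sv; rewrite -[v]scale1r; exact: S_lin. Qed.

Let E_add u v : S u -> S v -> E (u + v) = E u + E v.
Proof. by move=> Su Sv; rewrite -[v in LHS]scale1r E_lin// scale1r. Qed.

Definition direction u d : Prop :=
  S d /\ forall v, S v -> dot (E d *m K u) (E v) = dot (B u) (E v).

Lemma direction_exists u : S u -> exists d, direction u d.
Proof.
move=> Su.
have G0 : (E @` S) 0.
  by exists (s - s); [exact: S_sub|rewrite E_sub// subrr].
have GL (a : R) x y : (E @` S) x -> (E @` S) y -> (E @` S) (x + a *: y).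
  by move=> [x' Sx <-] [y' Sy <-]; exists (x' + a *: y'); [exact: S_lin|rewrite E_lin].
have [_ [d Sd <-] dP] := galerkin G0 GL mu_gt0 (K_coercive (u := u) ^~ Su) (B u).
by exists d; split => // v Sv; apply: dP; exists v.
Qed.

Definition admissible u d (t : R) : Prop :=
  W (u + t *: d) <= W u - sigmaA * t * dot (E d *m K u) (E d).

(** A threshold for step lengths, not the unit step: up to it, (1 - sigmaA) mu outweighs the
    second-order term t L / 2. A step rejected by backtracking exceeds it, so the next one exceeds
    [rho * full_step], whence [min_step]. *)
Definition full_step := 2 * (1 - sigmaA) * mu / L.

Definition min_step := Num.min 1 (rho * full_step).

Lemma full_step_gt0 : 0 < full_step.
Proof.
by move: sigmaA_range => /andP[? ?]; rewrite divr_gt0// !mulr_gt0//; lra.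
Qed.

Lemma min_step_gt0 : 0 < min_step.
Proof.
by move: rho_range => /andP[? _]; rewrite lt_min ltr01 mulr_gt0// full_step_gt0.
Qed.

Let WZ u d (t : R) : S u -> S d ->
  W (u + t *: d) <= W u - t * dot (B u) (E d) + L / 2 * t ^+ 2 * dot (E d) (E d).
Proof.
move=> Su Sd; have S0 : S 0 by rewrite -(subrr s); exact: S_sub.
have Std : S (t *: d) by rewrite -[t *: d]add0r; exact: S_lin.
have EZ : E (t *: d) = t *: E d.
  rewrite -[t *: d]add0r E_lin//; suff -> : E 0 = 0 by rewrite add0r.
  by rewrite -(subrr s) E_sub// subrr.
have := W_upper Su Std; rewrite EZ !dotZr dotZl.
by move: (W _) (W _) (dot _ _) (dot _ _) => *; lra.
Qed.

Lemma small_step_admissible u d (t : R) : S u -> direction u d ->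
  0 <= t <= full_step -> admissible u d t.
Proof.
move=> Su [Sd dP] /andP[t0 tf]; apply: (le_trans (WZ t Su Sd)).
have := K_coercive (E d) Su; rewrite -(dP _ Sd).
set a := dot (E d *m K u) (E d); set b := dot (E d) (E d) => ab.
have b0 : 0 <= b := dot_ge0 _.
move: tf; rewrite /full_step ler_pdivlMr// => tf.
have s1 : 0 <= 1 - sigmaA by case/andP: sigmaA_range => *; lra.
have h1 : t * ((1 - sigmaA) * (mu * b)) <= t * ((1 - sigmaA) * a).
  exact: ler_wpM2l (ler_wpM2l s1 ab).
have h2 : t * b / 2 * (t * L) <= t * b / 2 * (2 * (1 - sigmaA) * mu).
  by rewrite ler_wpM2l// divr_ge0// mulr_ge0.
by move: h1 h2; lra.
Qed.

(** This records just the consequences of backtracking on which the convergence analysis relies,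
    independently of how the step length is computed. *)
Definition newton_armijo_step u u' : Prop := exists d t,
  [/\ direction u d, u' = u + t *: d, admissible u d t, min_step <= t <= 1 &
      admissible u d 1 -> t = 1].

(** Chosen so that [decay] times the constant L^2 / (2 mu) of [gap_direction] equals
    [sigmaA * min_step * mu], the guaranteed decrease per squared length of the direction. *)
Definition decay := 2 * sigmaA * min_step * mu ^+ 2 / L ^+ 2.

Lemma decay_range : 0 < decay < 1.
Proof.
have m1 : min_step <= 1 by rewrite ge_min lexx.
have m0 := min_step_gt0; case/andP: sigmaA_range => sA0 sA1.
rewrite /decay divr_gt0 ?mulr_gt0 ?exprn_gt0//=.
rewrite ltr_pdivrMr ?exprn_gt0// mul1r.
have : mu ^+ 2 <= L ^+ 2 by rewrite ler_pXn2r ?nnegrE ?(ltW mu_gt0) ?(ltW L_gt0).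
have : 2 * sigmaA * min_step < 1.
  have : 2 * sigmaA * min_step <= 2 * sigmaA * 1.
    by rewrite ler_wpM2l// mulr_ge0// ltW.
  by move: sA1; lra.
have mu2 : 0 < mu ^+ 2 by rewrite exprn_gt0.
by rewrite -(ltr_pM2r mu2) mul1r => /lt_le_trans; apply.
Qed.

Lemma step_in_space u u' : S u -> newton_armijo_step u u' -> S u'.
Proof. by move=> Su [d [t [[Sd _] -> _ _ _]]]; exact: S_lin. Qed.

Lemma gap_lower u : S u -> mu / 2 * enorm (E (u - s)) ^+ 2 <= W u - W s.
Proof.
move=> Su; have Sus := S_sub Su Ss; have := W_lower Ss Sus.
by rewrite s_sol// addr0 (addrC s) subrK enorm_sqr.
Qed.

Lemma gap_upper u : S u -> W u - W s <= L / 2 * enorm (E (u - s)) ^+ 2.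
Proof.
move=> Su; have Sus := S_sub Su Ss; have := W_upper Ss Sus.
by rewrite s_sol// addr0 (addrC s) subrK enorm_sqr.
Qed.

(** An inequality of Polyak-Lojasiewicz type, with the Newton direction in the role of the gradient:
    strong convexity from [u] towards [s], the Newton equation, then Young's inequality. *)
Lemma gap_direction u d : S u -> direction u d ->
  W u - W s <= L ^+ 2 / (2 * mu) * dot (E d) (E d).
Proof.
move=> Su [Sd dP]; have Ssu := S_sub Ss Su.
have := W_lower Su Ssu; rewrite (addrC u) subrK -dP// => low.
have cs := cauchy_schwarz (E d *m K u) (E (s - u)).
have kb := ler_wpM2r (enorm_ge0 (E (s - u))) (K_bounded (E d) Su).
move: low; rewrite -!enorm_sqr => low.
move: (le_trans cs kb) low.
move: (dot _ _) (enorm (E d)) (enorm (E (s - u))) (W u) (W s) => a x y w w0.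
move=> h1 h2.
have : 0 <= (L * x - mu * y) ^+ 2 / (2 * mu) by rewrite divr_ge0 ?sqr_ge0// mulr_ge0// ltW.
have -> : (L * x - mu * y) ^+ 2 / (2 * mu) =
  L ^+ 2 / (2 * mu) * x ^+ 2 - L * x * y + mu / 2 * y ^+ 2 by field; rewrite gt_eqF.
lra.
Qed.

Lemma step_contraction u u' : S u -> newton_armijo_step u u' ->
  W u' - W s <= (1 - decay) * (W u - W s).
Proof.
move=> Su [d [t [dP -> adm /andP[t0 _] _]]].
have gd := gap_direction Su dP; have := K_coercive (E d) Su; move: adm; rewrite /admissible.
set a := dot (E d *m K u) (E d); set b := dot (E d) (E d) in gd * => adm ab.
have b0 : 0 <= b := dot_ge0 _; case/andP: sigmaA_range => sA0 _.
have h1 : sigmaA * min_step * (mu * b) <= sigmaA * t * a.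
  apply: ler_pM; rewrite ?mulr_ge0 ?(ltW sA0) ?(ltW min_step_gt0) ?(ltW mu_gt0)//.
  by rewrite ler_wpM2l// ltW.
have h2 : decay * (W u - W s) <= sigmaA * min_step * (mu * b).
  have -> : sigmaA * min_step * (mu * b) = decay * (L ^+ 2 / (2 * mu) * b).
    by rewrite /decay; field; rewrite !gt_eqF.
  by rewrite ler_wpM2l//; case/andP: decay_range => /ltW.
rewrite mulrBl mul1r lerBrDr (le_trans _ (_ : W u - W s - sigmaA * t * a + sigmaA * t * a <= _))//.
  by rewrite lerD ?(le_trans h2)// lerBlDr addrAC subrK.
by rewrite subrK.
Qed.

(** The new error [x] is itself a test vector. Since [B s] is orthogonal to it and the direction
    solves the Newton equation, [x] solves the linear system whose right-hand side is the
    semismoothness residual; coercivity concludes. *)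
Lemma newton_local (e : R) :
  (forall eta : R, 0 < eta -> exists2 delta : R, 0 < delta &
    forall u, S u -> enorm (E (u - s)) < delta ->
    enorm (E (u - s) *m K u - (B s - B u)) <= eta * enorm (E (u - s))) ->
  0 < e -> exists2 delta : R, 0 < delta & forall u d, S u -> direction u d ->
    enorm (E (u - s)) < delta -> enorm (E (u + d - s)) <= e * enorm (E (u - s)).
Proof.
move=> semi e0; have [delta d0 Hd] := semi _ (mulr_gt0 mu_gt0 e0).
exists delta => // u d Su [Sd dP] ud; have {}Hd := Hd _ Su ud.
have Sus := S_sub Su Ss; have Sx : S (u + d - s) by apply: S_sub => //; exact: S_add.
set x := E (u + d - s); set r := E (u - s) in Hd ud *.
have xE : x = r + E d by rewrite /x /r addrAC (E_add Sus Sd).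
have [->|x0] := eqVneq x 0.
  by rewrite enorm0 mulr_ge0 ?enorm_ge0// ltW.
rewrite -(ler_pM2r (enorm_gt0 x0)) -expr2 enorm_sqr -(ler_pM2l mu_gt0).
apply: (le_trans (K_coercive x Su)).
have -> : dot (x *m K u) x = dot (r *m K u - (B s - B u)) x.
  rewrite {1}xE mulmxDl dotDl (dP _ Sx) [in RHS]dotDl dotNl.
  by rewrite (dotDl (B s)) dotNl (s_sol Sx) sub0r opprK.
apply: (le_trans (cauchy_schwarz _ _)); rewrite !mulrA.
by apply: ler_wpM2r; rewrite ?enorm_ge0.
Qed.

(** After the full step the excess over [W s] is of order e^2, whereas the trapezoidal rule shows
    that the excess before was nearly half of minus the slope: [B s] drops out by orthogonality, and
    [B u] is replaced through the Newton equation. *)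
Lemma newton_full_step :
  (forall eta : R, 0 < eta -> exists2 delta : R, 0 < delta &
    forall u, S u -> enorm (E (u - s)) < delta ->
    enorm (E (u - s) *m K u - (B s - B u)) <= eta * enorm (E (u - s))) ->
  (forall eta : R, 0 < eta -> exists2 delta : R, 0 < delta &
    forall u, S u -> enorm (E (u - s)) < delta ->
    `|W u - W s + 2^-1 * dot (B u + B s) (E (u - s))| <= eta * enorm (E (u - s)) ^+ 2) ->
  exists2 delta : R, 0 < delta & forall u d, S u -> direction u d ->
    enorm (E (u - s)) < delta -> admissible u d 1.
Proof.
move=> semi trap; case/andP: sigmaA_range => sA0 sA1.
have g0 : 0 < (1 / 2 - sigmaA) * mu by rewrite mulr_gt0// subr_gt0.
set e := Num.min (1 / 2) ((1 / 2 - sigmaA) * mu / (6 * L)).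
have e0 : 0 < e by rewrite lt_min divr_gt0//= divr_gt0// mulr_gt0.
have e2 : e <= 1 / 2 by rewrite ge_min lexx.
have eL : 6 * (L * e) <= (1 / 2 - sigmaA) * mu.
  have : e <= (1 / 2 - sigmaA) * mu / (6 * L) by rewrite ge_min lexx orbT.
  by rewrite ler_pdivlMr ?mulr_gt0// mulrCA [e * _]mulrC.
have [d1 d10 H1] := newton_local semi e0.
have [d2 d20 H2] := trap _ (mulr_gt0 L_gt0 e0).
exists (Num.min d1 d2); first by rewrite lt_min d10.
move=> u d Su dir; rewrite lt_min => /andP[ud1 ud2].
have {}H1 := H1 _ _ Su dir ud1; have {}H2 := H2 _ Su ud2.
have [Sd dP] := dir.
have Sus := S_sub Su Ss; have Sud := S_add Su Sd; have Sx := S_sub Sud Ss.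
set x := E (u + d - s) in H1 *; set r := E (u - s) in H1 H2 ud1 ud2 *.
have xE : x = r + E d by rewrite /x /r addrAC (E_add Sus Sd).
have rd : enorm r <= 2 * enorm (E d).
  have := enormB x (E d); rewrite {1}xE addrK => h.
  have : e * enorm r <= 1 / 2 * enorm r by rewrite ler_wpM2r ?enorm_ge0.
  by move: h H1; move: (enorm x) (enorm r) (enorm (E d)) => *; lra.
have xd : enorm x <= 2 * e * enorm (E d).
  by rewrite (le_trans H1)// mulrC mulrAC ler_wpM2r// ltW.
have up := gap_upper Sud; rewrite -/x in up.
rewrite /admissible scale1r mulr1.
have cd := K_coercive (E d) Su.
have bs : dot (B u + B s) r = dot (E d *m K u) x - dot (E d *m K u) (E d).
  by rewrite dotDl (s_sol Sus) addr0 -(dP _ Sus) -/r xE dotDr addrK.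
rewrite bs in H2.
have cx : dot (E d *m K u) x <= L * enorm (E d) * (2 * e * enorm (E d)).
  rewrite (le_trans (cauchy_schwarz _ _))//.
  by rewrite ler_pM ?enorm_ge0// K_bounded.
have x2 : enorm x ^+ 2 <= (2 * e * enorm (E d)) ^+ 2.
  by rewrite ler_pXn2r ?nnegrE ?enorm_ge0// !mulr_ge0 ?enorm_ge0// ltW.
have r2 : enorm r ^+ 2 <= (2 * enorm (E d)) ^+ 2.
  by rewrite ler_pXn2r ?nnegrE ?enorm_ge0// mulr_ge0 ?enorm_ge0.
rewrite -enorm_sqr in cd.
have {}up : W (u + d) - W s <= L / 2 * (2 * e * enorm (E d)) ^+ 2.
  by rewrite (le_trans up)// ler_wpM2l// divr_ge0// ltW.
have {}H2 := le_trans H2 (ler_wpM2l (ltW (mulr_gt0 L_gt0 e0)) r2).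
by apply: (@full_step_real _ L e mu sigmaA (enorm (E d)) _ (dot (E d *m K u) x) _ _ (W s));
  rewrite ?enorm_ge0.
Qed.

Section iterates.
Variable u : nat -> V.
Hypothesis u0 : S (u 0%N).
Hypothesis u_step : forall n, newton_armijo_step (u n) (u n.+1).

Lemma iterate_in_space n : S (u n).
Proof. by elim: n => // n Sn; exact: step_in_space (u_step n). Qed.

Let gap_decay n : W (u n) - W s <= (1 - decay) ^+ n * (W (u 0%N) - W s).
Proof.
have q0 : 0 <= 1 - decay by case/andP: decay_range => *; lra.
elim: n => [|n IH]; first by rewrite expr0 mul1r.
rewrite exprS -mulrA (le_trans (step_contraction (iterate_in_space n) (u_step n)))//.
by rewrite ler_wpM2l.
Qed.

(** The gap of [W] decays geometrically and lies between mu / 2 and L / 2 times the squared error;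
    the square roots come from passing to the error itself. *)
Lemma iterate_linear_rate n : enorm (E (u n - s)) <=
  Num.sqrt (L / mu) * Num.sqrt (1 - decay) ^+ n * enorm (E (u 0%N - s)).
Proof.
have q0 : 0 <= 1 - decay by case/andP: decay_range => *; lra.
have Lmu : 0 <= L / mu by rewrite divr_ge0// ltW.
rewrite -(@ler_pXn2r _ 2)// ?nnegrE ?enorm_ge0//; last first.
  by rewrite mulr_ge0 ?enorm_ge0// mulr_ge0 ?exprn_ge0// sqrtr_ge0.
have sq (a b c : R) : (a * b * c) ^+ 2 = a ^+ 2 * b ^+ 2 * c ^+ 2 by rewrite !exprMn.
rewrite sq (sqr_sqrtr Lmu) -exprM mulnC exprM (sqr_sqrtr q0).
have mu2 : 0 < mu / 2 by rewrite divr_gt0.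
rewrite -(ler_pM2l mu2) (le_trans (gap_lower (iterate_in_space n)))//.
rewrite (le_trans (gap_decay n))//.
have -> : mu / 2 * (L / mu * (1 - decay) ^+ n * enorm (E (u 0%N - s)) ^+ 2) =
  (1 - decay) ^+ n * (L / 2 * enorm (E (u 0%N - s)) ^+ 2).
  by move: (_ ^+ n) (_ ^+ 2) => a b; field; rewrite gt_eqF.
by rewrite ler_wpM2l ?exprn_ge0// gap_upper.
Qed.

Lemma iterate_superlinear (e : R) :
  (forall eta : R, 0 < eta -> exists2 delta : R, 0 < delta &
    forall u, S u -> enorm (E (u - s)) < delta ->
    enorm (E (u - s) *m K u - (B s - B u)) <= eta * enorm (E (u - s))) ->
  (forall eta : R, 0 < eta -> exists2 delta : R, 0 < delta &
    forall u, S u -> enorm (E (u - s)) < delta ->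
    `|W u - W s + 2^-1 * dot (B u + B s) (E (u - s))| <= eta * enorm (E (u - s)) ^+ 2) ->
  0 < e -> \forall n \near \oo, enorm (E (u n.+1 - s)) <= e * enorm (E (u n - s)).
Proof.
move=> semi trap e0.
have [d1 d10 H1] := newton_local semi e0.
have [d2 d20 H2] := newton_full_step semi trap.
have q1 : `|Num.sqrt (1 - decay)| < 1.
  rewrite ger0_norm ?sqrtr_ge0// -[ltRHS]sqrtr1 ltr_sqrt ?ltr01//.
  by case/andP: decay_range => *; lra.
set C := Num.sqrt (L / mu) * enorm (E (u 0%N - s)).
have C0 : 0 <= C by rewrite mulr_ge0 ?sqrtr_ge0 ?enorm_ge0.
have d0 : 0 < Num.min d1 d2 / (C + 1) by rewrite divr_gt0 ?ltr_wpDl// lt_min d10.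
have /cvgrPdist_lt/(_ _ d0) := cvg_expr q1.
apply: filterS => n; rewrite sub0r normrN normrX (ger0_norm (sqrtr_ge0 _)) => qn.
have : enorm (E (u n - s)) < Num.min d1 d2.
  rewrite (le_lt_trans (iterate_linear_rate n))// mulrAC -/C mulrC.
  move: qn; rewrite ltr_pdivlMr ?ltr_wpDl//; apply: le_lt_trans.
  by rewrite ler_wpM2l ?exprn_ge0 ?sqrtr_ge0// lerDl.
rewrite lt_min => /andP[n1 n2].
have [d [t [dir un _ _ t1]]] := u_step n.
have te : t = 1 by apply: t1; exact: H2 (iterate_in_space n) dir n2.
by rewrite un te scale1r; exact: H1 (iterate_in_space n) dir n1.
Qed.

End iterates.

End newton_armijo.

(** * Lebesgue measure on row vectors and the space Vh *)

Section row_measure.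
Variables (R : realType).

Definition box n (x : 'rV[R]_n) (e : R) : set 'rV[R]_n :=
  [set y | forall i, `|y ord0 i - x ord0 i| < e].

Lemma measurable_box n (x : 'rV[R]_n) (e : R) : measurable (box x e).
Proof.
have -> : box x e = \bigcap_(i in [set: 'I_n]) ((fun y : 'rV[R]_n => y ord0 i) @^-1` ball (x ord0 i) e).
  apply/seteqP; split => y /=.
    by move=> H i _; rewrite /= /ball/= distrC; exact: H.
  by move=> H i; rewrite distrC; exact: (H i I).
apply: fin_bigcap_measurable; first exact: finite_finset.
move=> i _; rewrite -[X in measurable X]setTI; apply: measurable_coord => //.
exact: measurable_ball.
Qed.

Lemma box_ball n (x : 'rV[R]_n) (e : R) : 0 < e -> box x e = ball x e.
Proof.
move=> e0; apply/seteqP; split => y H.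
  by split=> // i j; rewrite (ord1 i) /ball/= distrC; exact: H.
by move=> i; rewrite distrC; case: H => _ /(_ ord0 i).
Qed.

(** The sigma-algebra is generated by the coordinates, so an open set is written as a countable
    union of cubes with rational centres and radii 1 / (k + 1). *)
Lemma open_measurable_row n (A : set 'rV[R]_n) : open A -> measurable A.
Proof.
move=> oA.
pose F (p : 'rV[rat]_n * nat) : set 'rV[R]_n :=
  let B := box (map_mx ratr p.1) p.2.+1%:R^-1 in if `[< B `<=` A >] then B else set0.
have -> : A = \bigcup_p F p.
  apply/seteqP; split => x; last first.
    by move=> [p _]; rewrite /F; case: asboolP => // H; exact: H.
  move=> Ax; have /nbhs_ballP[e /= e0 eA] : nbhs x A by exact: oA.
  have e20 : 0 < e / 2 by rewrite divr_gt0.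
  have [N _ HN] := near_infty_natSinv_lt (PosNum e20).
  have N0 : 0 < N.+1%:R^-1 :> R by rewrite invr_gt0.
  have qP i : exists q : rat, `|x ord0 i - ratr q| < N.+1%:R^-1.
    move: N0; move: (N.+1%:R^-1 : R) => a a0.
    have /rat_in_itvoo[q] : x ord0 i - a < x ord0 i + a by lra.
    rewrite in_itv/= => /andP[q1 q2]; exists q.
    by rewrite ltr_norml; apply/andP; split; lra.
  have [q qx] := choice qP.
  exists (\row_i q i, N) => //; rewrite /F /=.
  have xB : box (map_mx ratr (\row_i q i)) N.+1%:R^-1 x by move=> i; rewrite !mxE.
  case: asboolP => // -[]; move=> y yB; apply: eA; rewrite -box_ball// => i.
  have := ler_distD (ratr (q i)) (y ord0 i) (x ord0 i).
  have := yB i; have := qx i; have := HN N (leqnn N); rewrite !mxE /= (distrC (ratr _)).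
  by move: N.+1%:R^-1 `|_| `|_| `|_| => *; lra.
apply: countable_bigcupT_measurable => // p; rewrite /F.
by case: asboolP => _; [exact: measurable_box|exact: measurable0].
Qed.

Lemma continuous_measurable_row n (f : 'rV[R]_n -> R) :
  continuous f -> measurable_fun setT f.
Proof.
move=> /continuousP cf; apply: (measurability _ (RGenOInfty.measurableE R)) => //.
move=> _ [_ [x ->] <-]; rewrite setTI; apply: open_measurable_row; apply: cf.
exact: interval_open.
Qed.

(** Positivity makes an almost everywhere inequality hold at points of continuity; finiteness bounds
    the measure of the domain. *)
Lemma lebesgue_row_box n (x : 'rV[R]_n) (e : R) : 0 < e ->
  (0 < lebesgue_row R n (box x e) < +oo)%E.
Proof.
move=> e0; elim: n => [|n IH] in x *.
  rewrite /= diracE mem_set ?lte01 ?ltry//.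
  by move=> [].
rewrite /= /lebesgue_rowS /pushforward.
have -> : @cons_row R n @^-1` box x e =
    ball (x ord0 ord0) e `*` box (\row_i x ord0 (lift ord0 i)) e.
  apply/seteqP; split => -[a v] /=.
    move=> H; split => [|i]; first by have := H ord0; rewrite cons_row0 distrC.
    by have := H (lift ord0 i); rewrite cons_rowS mxE.
  move=> [/= H1 H2] i; case: (unliftP ord0 i) => [j|] ->.
    by rewrite cons_rowS; have := H2 j; rewrite mxE.
  by rewrite cons_row0 distrC.
rewrite product_measure1E; [|exact: measurable_ball|exact: measurable_box].
have /andP[b0 b1] := IH (\row_i x ord0 (lift ord0 i)).
set m1 := (X in (0 < X * _ < _)%E).
have -> : m1 = (e *+ 2)%:E by apply: lebesgue_measure_ball; exact: ltW.
by rewrite mule_gt0 ?lte_fin ?mulrn_wgt0// lte_mul_pinfty ?lee_fin ?mulrn_wge0 ?ltW.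
Qed.

End row_measure.

(** * Closure of [Vh] under linear combinations *)

Section square_integrable.
Variables (R : realType) (n : nat) (Omega : set 'rV[R]_n).
Hypothesis Omega_open : open Omega.
Hypothesis Omega_bounded : bounded_set Omega.
Implicit Types (f g phi : 'rV[R]_n -> R).

Let mO : measurable Omega := open_measurable_row Omega_open.

Lemma bounded_set_in_ball : exists2 M : R, 0 < M & Omega `<=` [set x | `|x| <= M].
Proof.
have [M [_ HM]] := Omega_bounded; exists (`|M| + 1); first by rewrite ltr_wpDl.
by move=> x Ox; apply: HM => //; rewrite (le_lt_trans (ler_norm M))// ltrDl.
Qed.

Lemma finite_measure_Omega : (lebesgue_row R n Omega < +oo)%E.
Proof.
have [M M0 OM] := bounded_set_in_ball.
have M1 : 0 < M + 1 by rewrite ltr_wpDr// ltW.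
have /andP[_] := lebesgue_row_box (0 : 'rV[R]_n) M1; apply: le_lt_trans.
apply: le_measure; rewrite ?inE//; first exact: measurable_box.
move=> x /OM/= xM i; rewrite mxE subr0 (le_lt_trans (coord_le_norm _ _ _))//.
by rewrite (le_lt_trans xM)// ltrDl.
Qed.

Lemma L2_mul f g : L2 Omega f -> L2 Omega g ->
  (lebesgue_row R n).-integrable Omega (fun x => (f x * g x)%:E).
Proof.
move=> [mf f2] [mg g2].
have := integrableD mO f2 g2; apply: le_integrable => //.
  by apply/measurable_EFinP; exact: measurable_funM.
move=> x _; rewrite -EFinD !abse_EFin lee_fin normrM.
rewrite [leRHS]ger0_norm ?addr_ge0 ?sqr_ge0//.
rewrite -(@real_normK _ (f x)) ?num_real// -(@real_normK _ (g x)) ?num_real//.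
move: `|f x| `|g x| (normr_ge0 (f x)) (normr_ge0 (g x)) => a b a0 b0.
nra.
Qed.

Lemma L2_bounded f (C : R) : measurable_fun Omega f ->
  (forall x, Omega x -> `|f x| <= C) -> L2 Omega f.
Proof.
move=> mf fC; split => //.
apply: (measurable_bounded_integrable mO finite_measure_Omega).
  exact: measurable_funX.
exists (C ^+ 2); split; first exact: num_real.
move=> y Cy x Ox; rewrite /= normrX (le_trans _ (ltW Cy))//.
by rewrite ler_pXn2r ?nnegrE ?fC// (le_trans _ (fC _ Ox)).
Qed.

Lemma L2_lin (a : R) f g : L2 Omega f -> L2 Omega g -> L2 Omega (f + a *: g).
Proof.
move=> Lf Lg; have [mf f2] := Lf; have [mg g2] := Lg; split.
  by apply: measurable_funD => //; exact: measurable_funM.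
have := integrableD mO f2 (integrableD mO (integrableZl mO (2 * a) (L2_mul Lf Lg))
  (integrableZl mO (a ^+ 2) g2)).
apply: eq_integrable => // x _ /=.
have -> : (f + a *: g) x = f x + a * g x by [].
by rewrite -!EFinM -!EFinD; congr EFin; ring.
Qed.

Lemma L2_continuous f : continuous f -> L2 Omega f.
Proof.
move=> cf; have [M M0 OM] := bounded_set_in_ball.
apply: (@L2_bounded _ (sup [set `|f x| | x in [set v : 'rV[R]_n | forall i, v ord0 i \in `[- M, M]]])).
  exact: measurable_funTS (continuous_measurable_row cf).
move=> x Ox; apply: ub_le_sup; last first.
  exists x => // i /=; rewrite in_itv/= -ler_norml (le_trans (coord_le_norm _ _ _))//.
  exact: OM.
have /compact_bounded[C [_ HC]] : compact (f @` [set v : 'rV[R]_n | forall i, v ord0 i \in `[- M, M]]).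
  apply: continuous_compact; first exact: continuous_subspaceT.
  by apply: (@rV_compact _ _ (fun=> [set` `[- M, M]])) => i; exact: segment_compact.
exists (C + 1) => _ [y yM <-]; apply: (HC (C + 1)); first by rewrite ltrDl.
by exists y.
Qed.

Lemma integral_lin (a : R) f g :
  (lebesgue_row R n).-integrable Omega (EFin \o f) ->
  (lebesgue_row R n).-integrable Omega (EFin \o g) ->
  (\int[lebesgue_row R n]_(x in Omega) (f x + a * g x)%:E =
   \int[lebesgue_row R n]_(x in Omega) (f x)%:E +
   a%:E * \int[lebesgue_row R n]_(x in Omega) (g x)%:E)%E.
Proof.
move=> If Ig; rewrite -integralZl// -integralD//; exact: integrableZl.
Qed.

(** The integrals are extended real numbers, so linearity requires integrable products: test
    functions and their partial derivatives are continuous, hence in L2 of the bounded domain. *)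
Lemma weak_partial_lin i (a : R) f f' g g' :
  L2 Omega f -> L2 Omega f' -> L2 Omega g -> L2 Omega g' ->
  weak_partial Omega i f f' -> weak_partial Omega i g g' ->
  weak_partial Omega i (f + a *: g) (f' + a *: g').
Proof.
move=> Lf Lf' Lg Lg' wf wg phi tphi; have [sphi _] := tphi.
have Lp : L2 Omega phi.
  by apply: L2_continuous => x; exact: differentiable_continuous (sphi [::] x).
have Ldp : L2 Omega (partial i phi).
  by apply: L2_continuous => x; exact: differentiable_continuous (sphi [:: i] x).
have E1 h : (\int[lebesgue_row R n]_(x in Omega) ((f + a *: g) x * h x)%:E =
  \int[lebesgue_row R n]_(x in Omega) (f x * h x + a * (g x * h x))%:E)%E.
  by apply: eq_integral => x _; rewrite mulrDl mulrA.
have E2 h : (\int[lebesgue_row R n]_(x in Omega) ((f' + a *: g') x * h x)%:E =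
  \int[lebesgue_row R n]_(x in Omega) (f' x * h x + a * (g' x * h x))%:E)%E.
  by apply: eq_integral => x _; rewrite mulrDl mulrA.
rewrite E1 E2 !integral_lin; try exact: L2_mul.
rewrite (wf _ tphi) (wg _ tphi) muleN oppeD//.
have := integrable_fin_num mO (L2_mul Lf' Lp); rewrite /= => h1.
have := integrable_fin_num mO (L2_mul Lg' Lp); rewrite /= => h2.
by rewrite fin_num_adde_defr// .
Qed.

Lemma H1_lin (a : R) f g : H1 Omega f -> H1 Omega g -> H1 Omega (f + a *: g).
Proof.
move=> [Lf df] [Lg dg]; split; first exact: L2_lin.
move=> i; have [f' Lf' wf] := df i; have [g' Lg' wg] := dg i.
by exists (f' + a *: g'); [exact: L2_lin|exact: weak_partial_lin].
Qed.

Lemma Vh_lin (Th : mesh R n) (a : R) f g :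
  Vh Omega Th f -> Vh Omega Th g -> Vh Omega Th (f + a *: g).
Proof.
move=> [Hf If Af] [Hg Ig Ag]; split; first exact: H1_lin.
  have L1 : L2 Omega (fun=> 1) by apply: L2_continuous; exact: cst_continuous.
  have int1 h : L2 Omega h -> (lebesgue_row R n).-integrable Omega (EFin \o h).
    move=> Lh; apply: eq_integrable (L2_mul Lh L1) => // x _ /=.
    by rewrite mulr1.
  have := @integral_lin a f g (int1 _ Hf.1) (int1 _ Hg.1).
  by rewrite If Ig mule0 adde0.
move=> k; have [p [b fE]] := Af k; have [p' [b' gE]] := Ag k.
exists (p + a *: p'), (b + a * b') => x Tx.
have -> : (f + a *: g) x = f x + a * g x by [].
by rewrite (fE _ Tx) (gE _ Tx) dotDl dotZl; ring.
Qed.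

End square_integrable.

(** * Simplices and mesh points *)

Section simplex_geometry.
Variables (R : realType) (d : nat).
Implicit Types (T : 'M[R]_(d.+1, d)) (x y : 'rV[R]_d).

Lemma simplex_barycentric T x (c : 'rV[R]_d) :
  let A := \matrix_(i < d, j < d) (T (lift ord0 i) j - T ord0 j) in
  x = row ord0 T + c *m A ->
  (forall i, 0 <= c ord0 i) -> \sum_i c ord0 i <= 1 -> simplex T x.
Proof.
move=> A xE c0 c1; exists (cons_row (1 - \sum_i c ord0 i, c)); split.
- move=> i; case: (unliftP ord0 i) => [j|] ->; first by rewrite cons_rowS.
  by rewrite cons_row0 subr_ge0.
- rewrite big_ord_recl cons_row0 /=.
  by under [X in _ + X]eq_bigr do rewrite cons_rowS; rewrite subrK.
- by move=> i; rewrite inE.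
apply/rowP => j; rewrite xE [in RHS]mxE big_ord_recl cons_row0 /=.
under [X in _ = _ + X]eq_bigr do rewrite cons_rowS.
rewrite !mxE.
under [X in _ + X = _]eq_bigr do rewrite /A mxE mulrBr.
by rewrite sumrB -mulr_suml /=; ring.
Qed.

Lemma barycenter_interior T : Defs.nondegenerate T -> (simplex T)° (barycenter T).
Proof.
rewrite /Defs.nondegenerate; set A := \matrix_(i, j) _ => nT.
pose c y := (y - row ord0 T) *m invmx A.
have cE y : y = row ord0 T + c y *m A by rewrite /c mulmxKV// addrC subrK.
have cb : c (barycenter T) = const_mx d.+1%:R^-1.
  apply: (can_inj (mulmxK nT)); rewrite /c mulmxKV//.
  apply/rowP => j; rewrite !mxE summxE big_ord_recl.
  under [in RHS]eq_bigr do rewrite !mxE.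
  rewrite -mulr_sumr sumrB sumr_const card_ord mxE.
  under eq_bigr do rewrite mxE.
  by rewrite -mulr_natl -natr1; field; rewrite natr1 pnatr_eq0.
set C := d.+1%:R * d%:R * `|invmx A|.
have C0 : 0 <= C by rewrite !mulr_ge0.
set N : R := d.+1%:R; have N0 : 0 < N by rewrite ltr0n.
(* With N = d + 1, all edge coordinates of the barycenter are 1 / N. Changing each by at most 1 /
   N^2 keeps them nonnegative and their sum at most (N - 1) (1 / N + 1 / N^2) = 1 - 1 / N^2. *)
have e0 : 0 < (N * N)^-1 / (C + 1) by rewrite divr_gt0 ?invr_gt0 ?mulr_gt0// ltr_wpDl.
apply: filterS (enorm_ball (barycenter T) e0) => y /= yb.
have cy i : `|c y ord0 i - N^-1| <= (N * N)^-1.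
  have -> : c y ord0 i - N^-1 = ((y - barycenter T) *m invmx A) ord0 i.
    have -> : y - barycenter T = (y - row ord0 T) - (barycenter T - row ord0 T).
      by apply/rowP => k; rewrite !mxE; ring.
    by rewrite mulmxBl -/(c y) -/(c (barycenter T)) cb !mxE.
  apply: (le_trans (coord_le_norm _ _ _)); apply: (le_trans (normr_le_enorm _)).
  apply: (le_trans (enorm_mulmx _ _)); rewrite -/C.
  move: yb; rewrite ltr_pdivlMr ?ltr_wpDl// => /ltW; apply: le_trans.
  by rewrite mulrC ler_wpM2l ?enorm_ge0// lerDl.
have N1 : (N * N)^-1 <= N^-1.
  by rewrite invfM ler_piMr ?invr_ge0 ?(ltW N0)// invf_le1// ler1n.
apply: (simplex_barycentric (cE y)).
  move=> i; have := cy i; rewrite ler_norml lerBrDr => /andP[+ _].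
  by apply: le_trans; rewrite addrC subr_ge0.
apply: (@le_trans _ _ (\sum_(i < d) (N^-1 + (N * N)^-1))).
  by apply: ler_sum => i _; have := cy i; rewrite ler_norml lerBlDl => /andP[_].
rewrite sumr_const card_ord -mulr_natl.
have -> : d%:R = N - 1 by rewrite /N -natr1 addrK.
have -> : (N - 1) * (N^-1 + (N * N)^-1) = 1 - (N * N)^-1 by field; rewrite gt_eqF.
by rewrite gerBl invr_ge0 mulr_ge0// ltW.
Qed.

Lemma grad_affine (A : set 'rV[R]_d) (v : 'rV[R]_d -> R) (a : 'rV[R]_d) (b : R) x :
  A° x -> (forall y, A y -> v y = dot a y + b) -> grad v x = a.
Proof.
move=> Ax vE; apply/rowP => i; rewrite mxE /partial /derive.
have [e e0 eA] := nbhs_enorm Ax; have Axx : A x by apply: eA; rewrite subrr enorm0.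
apply: lim_near_cst => //.
have b0 : 0 < e / (enorm (basis_row R i) + 1).
  by rewrite divr_gt0// ltr_wpDl ?enorm_ge0.
near=> h.
have h0 : h != 0 by near: h; exact: nbhs_dnbhs_neq.
have he : `|h| < e / (enorm (basis_row R i) + 1) by near: h; exact: dnbhs0_lt.
have Ah : A (h *: basis_row R i + x).
  apply: eA; rewrite addrK enormZ; move: he; rewrite ltr_pdivlMr ?ltr_wpDl ?enorm_ge0//.
  by apply: le_lt_trans; rewrite ler_wpM2l// lerDl.
rewrite /= (vE _ Ah) (vE _ Axx) dotDr dotZr dot_basis /GRing.scale/=.
by rewrite opprD addrACA subrr addr0 addrK mulKf.
Unshelve. all: by end_near. Qed.

End simplex_geometry.

Section mesh_points.
Variables (R : realType) (d : nat) (Omega : set 'rV[R]_d) (Th : mesh R d).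
Hypothesis Th_conf : conforming_partition Omega Th.

Let xT k := barycenter (cell Th k).

Lemma mesh_point_interior k : (simplex (cell Th k))° (xT k).
Proof. by have [nd _ _ _ _] := Th_conf; exact: barycenter_interior. Qed.

Lemma mesh_point_domain k : Omega (xT k).
Proof. by have [_ _ sO _ _] := Th_conf; exact: sO (mesh_point_interior k). Qed.

(** [grad] is not additive on arbitrary functions, being defined by limits that may fail to exist;
    barycenters are interior to cells on which elements of [Vh] are affine. *)
Lemma grad_Vh_lin (a : R) (f g : 'rV[R]_d -> R) k :
  Vh Omega Th f -> Vh Omega Th g ->
  grad (f + a *: g) (xT k) = grad f (xT k) + a *: grad g (xT k).
Proof.
move=> [_ _ Af] [_ _ Ag]; have [p [b fE]] := Af k; have [p' [b' gE]] := Ag k.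
have Ik := mesh_point_interior k.
rewrite (grad_affine Ik fE) (grad_affine Ik gE).
apply: (@grad_affine _ _ _ _ _ (b + a * b') _ Ik) => y Ty.
have -> : (f + a *: g) y = f y + a * g y by [].
by rewrite (fE _ Ty) (gE _ Ty) dotDl dotZl; ring.
Qed.

(** The quadrature needs the sign at single points. A negative value at the barycenter would
    persist, by continuity inside the cell, on a cube of positive measure. *)
Lemma chi_ge0_mesh_point (chi : 'rV[R]_d -> R) k :
  {ae lebesgue_row R d, forall x, Omega x -> 0 <= chi x} ->
  piecewise_continuous Th chi -> 0 <= chi (xT k).
Proof.
move=> [N [mN N0 chiN]] /(_ k)[g [cg chig]].
have Ik := mesh_point_interior k; rewrite leNgt; apply/negP => chi_lt0.
have [_ _ sO _ _] := Th_conf.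
have cgx : {for xT k, continuous g}.
  have := continuous_subspaceW (@interior_subset _ (simplex (cell Th k))) cg.
  rewrite continuous_open_subspace; last exact: open_interior.
  by apply; rewrite inE.
have gx0 : g (xT k) < 0 by rewrite -chig.
have : \forall y \near xT k, (simplex (cell Th k))° y /\ g y < 0.
  near=> y; split; near: y; first exact: open_nbhs_nbhs (conj (@open_interior _ _) Ik).
  exact: cgx (lt_nbhsl gx0).
move=> /nbhs_ballP[e /= e0 eB].
have /andP[+ _] := lebesgue_row_box (xT k) e0; rewrite -N0 ltNge => /negP[].
apply: le_measure; rewrite ?inE//; first exact: measurable_box.
rewrite box_ball// => y /eB[Iy gy]; apply: chiN => /= /(_ (sO k _ Iy)).
by rewrite chig// leNgt gy.
Unshelve. all: by end_near. Qed.

End mesh_points.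

(** * The discrete problem *)

Lemma dot_mxvec (R : realType) (N d : nat) (A B : 'M[R]_(N, d)) :
  dot (mxvec A) (mxvec B) = \sum_k dot (row k A) (row k B).
Proof.
rewrite /dot (reindex _ (curry_mxvec_bij N d)) /=.
under [in RHS]eq_bigr do under eq_bigr do rewrite !mxE.
by rewrite pair_bigA; apply: eq_bigr => -[i j] _; rewrite /= !mxvecE.
Qed.

Section block_matrix.
Variables (R : realType) (N d : nat) (A : 'I_N -> 'M[R]_d).

Definition block_apply (x : 'rV[R]_(N * d)) : 'rV[R]_(N * d) :=
  mxvec (\matrix_(k < N) (row k (vec_mx x) *m A k)).

Let block_apply_linear : linear block_apply.
Proof.
move=> a x y; rewrite /block_apply -linearP; congr mxvec.
apply/row_matrixP => k; rewrite rowK !linearP /= mulmxDl -scalemxAl.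
by congr (_ *: _ + _); apply/rowP => j; rewrite [RHS]mxE [RHS]mxE.
Qed.

HB.instance Definition _ := GRing.isLinear.Build R _ _ _ block_apply block_apply_linear.

Definition block_mx : 'M[R]_(N * d) := lin1_mx block_apply.

Lemma mulmx_block x : x *m block_mx = block_apply x.
Proof. exact: mul_rV_lin1. Qed.

End block_matrix.

(** The reciprocal of 1 plus the sum of reciprocals stands in for a minimum and covers the empty
    family. *)
Lemma common_radius (R : realType) (N : nat) (delta : 'I_N -> R) :
  (forall k, 0 < delta k) -> exists2 e : R, 0 < e & forall k, e <= delta k.
Proof.
move=> d0; have s0 : 0 <= \sum_k (delta k)^-1.
  by apply: sumr_ge0 => k _; rewrite invr_ge0 ltW.
have s1 : 0 < 1 + \sum_k (delta k)^-1 by rewrite ltr_wpDr.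
exists (1 + \sum_k (delta k)^-1)^-1; first by rewrite invr_gt0.
move=> k; rewrite -[leRHS]invrK lef_pV2 ?posrE ?invr_gt0// (bigD1 k)//= addrCA lerDl.
by rewrite addr_ge0// sumr_ge0// => j _; rewrite invr_ge0 ltW.
Qed.

(* The steps rho ^+ m accumulate at 0 only, so that their supremum is the first
   accepted one; its predecessor was rejected, hence exceeds t0. *)
Lemma armijo_sup (R : realType) (rho t0 : R) (adm : R -> Prop) :
  0 < rho < 1 -> 0 < t0 -> (forall t, 0 <= t <= t0 -> adm t) ->
  let t := sup [set tau | exists2 m : nat, tau = rho ^+ m & adm tau] in
  [/\ adm t, Num.min 1 (rho * t0) <= t <= 1 & adm 1 -> t = 1].
Proof.
move=> /andP[r0 r1] t00 small t.
have rm m : 0 <= rho ^+ m by rewrite exprn_ge0// ltW.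
have exm : exists m, `[< adm (rho ^+ m) >].
  have : (rho ^+ m @[m --> \oo] --> (0 : R)).
    by apply: cvg_expr; rewrite ger0_norm// ltW.
  move=> /cvgrPdist_lt/(_ _ t00)[m _ Hm]; exists m; apply/asboolP; apply: small.
  by rewrite rm/= ltW//; have := Hm m (leqnn m); rewrite /= sub0r normrN ger0_norm.
case: (ex_minnP exm) => m /asboolP admm mmin.
have tE : t = rho ^+ m.
  apply/eqP; rewrite eq_le; apply/andP; split.
    apply: ge_sup; first by exists (rho ^+ m), m.
    move=> _ [k -> admk]; rewrite ler_wiXn2l ?(ltW r0) ?(ltW r1)//.
    by apply: mmin; apply/asboolP.
  apply: ub_le_sup; last by exists m.
  by exists 1 => _ [k -> _]; rewrite exprn_ile1// ltW.
split; first by rewrite tE.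
  rewrite tE exprn_ile1 ?(ltW r0) ?(ltW r1)// andbT.
  case: m mmin {tE admm} => [|m] mmin; first by rewrite expr0 ge_min lexx.
  rewrite ge_min exprS ler_pM2l//; apply/orP; right.
  rewrite leNgt; apply/negP => lt; have : (m < m)%N.
    by apply: mmin; apply/asboolP; apply: small; rewrite rm ltW.
  by rewrite ltnn.
move=> adm1; rewrite tE.
by have := mmin 0%N; rewrite expr0 leqn0 => /(_ (asboolT adm1))/eqP ->.
Qed.

Section discrete_problem.
Variables (R : realType) (d : nat) (M : model R d) (sigma sigmaA rho : R) (Th : mesh R d).
Hypothesis sigma_gt0 : 0 < sigma.
Hypothesis mu0_gt0 : 0 < mu0 M.
Hypothesis Omega_open : open (Omega M).
Hypothesis Omega_bounded : bounded_set (Omega M).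
Hypothesis Th_conf : conforming_partition (Omega M) Th.
Hypothesis U_gtNy : forall x J, Omega M x -> (-oo < U M x J)%E.
Hypothesis sigmaA_range : 0 < sigmaA < 1 / 2.
Hypothesis rho_range : 0 < rho < 1.

Let N := ncells Th.
Let xT (k : 'I_N) := barycenter (cell Th k).
Let w (k : 'I_N) := volume (cell Th k).

Hypothesis chi_ge0 : forall k, 0 <= chi M (xT k).
Hypothesis U_reg : forall k, regular_energy sigma (U M (xT k)).

Let V := 'rV[R]_d -> R.
Let S : set V := Vh (Omega M) Th.
Let L := lipschitz_constant M sigma.
Let mu := mu0 M.

Let w_ge0 k : 0 <= w k.
Proof. by rewrite fine_ge0. Qed.

Let UxT k J : (-oo < U M (xT k) J)%E.
Proof. by apply: U_gtNy; exact: (mesh_point_domain Th_conf). Qed.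

(** The square roots of the weights make the Euclidean product of these vectors the discrete product
    [hdot]. *)
Definition field_vec (u : 'rV[R]_d -> 'rV[R]_d) : 'rV[R]_(N * d) :=
  mxvec (\matrix_(k < N) (Num.sqrt (w k) *: u (xT k))).

Lemma dot_field_vec u v : dot (field_vec u) (field_vec v) = hdot Th u v.
Proof.
rewrite dot_mxvec; apply: eq_bigr => k _; rewrite !rowK dotZl dotZr mulrA mulrC.
by rewrite -expr2 sqr_sqrtr.
Qed.

Lemma field_vec_sub u v : field_vec u - field_vec v = field_vec (fun x => u x - v x).
Proof.
rewrite /field_vec -linearB; congr mxvec.
by apply/matrixP => k j; rewrite !mxE mulrBr.
Qed.

Definition grad_vec (psi : V) := field_vec (grad psi).
Definition induction_vec (psi : V) :=
  field_vec (fun x => induction M x (magnetic_field M psi x)).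
Definition total_coenergy (psi : V) :=
  quadrature Th (fun x => coenergy M x (magnetic_field M psi x)).
Definition newton_mx (psi : V) : 'M[R]_(N * d) :=
  block_mx (fun k => (newton_matrix M (xT k) (magnetic_field M psi (xT k)))^T).

Let E := grad_vec.
Let B := induction_vec.
Let W := total_coenergy.
Let K := newton_mx.

Lemma mulmx_newton_vec psi u :
  field_vec u *m K psi =
  field_vec (fun x => u x *m (newton_matrix M x (magnetic_field M psi x))^T).
Proof.
rewrite mulmx_block /block_apply /field_vec mxvecK; congr mxvec.
by apply/row_matrixP => k; rewrite !rowK scalemxAl.
Qed.

Lemma S_lin (a : R) (u v : V) : S u -> S v -> S (u + a *: v).
Proof. exact: Vh_lin. Qed.

Lemma E_lin (a : R) (u v : V) : S u -> S v -> E (u + a *: v) = E u + a *: E v.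
Proof.
move=> Su Sv; rewrite /E /grad_vec /field_vec -linearZ -linearD; congr mxvec.
apply/row_matrixP => k; rewrite linearD linearZ /= !rowK.
by rewrite (grad_Vh_lin Th_conf a k Su Sv) scalerDr !scalerA [a * _]mulrC.
Qed.

Let field_diff (u v : V) k : S u -> S v ->
  magnetic_field M (u + v) (xT k) = magnetic_field M u (xT k) - grad v (xT k).
Proof.
move=> Su Sv; rewrite /magnetic_field -[v in LHS]scale1r (grad_Vh_lin Th_conf 1 k Su Sv).
by rewrite scale1r opprD addrA.
Qed.

Let sub_sub_id (a g : 'rV[R]_d) : a - g - a = - g.
Proof. by rewrite addrAC subrr sub0r. Qed.

Lemma total_coenergy_expand (u v : V) : S u -> S v ->
  W (u + v) - W u + dot (B u) (E v) = \sum_k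
   (let H0 := magnetic_field M u (xT k) in let H := H0 - grad v (xT k) in
    coenergy M (xT k) H - coenergy M (xT k) H0
      - dot (induction M (xT k) H0) (H - H0)) * w k.
Proof.
move=> Su Sv; rewrite dot_field_vec /W /total_coenergy /hdot /quadrature.
rewrite -sumrB -big_split; apply: eq_bigr => k _ /=.
rewrite (field_diff k Su Sv) sub_sub_id dotNr opprK.
by rewrite -/(xT k) -/(w k) -mulrBl -mulrDl.
Qed.

Let normE (v : V) : dot (E v) (E v) = \sum_k dot (grad v (xT k)) (grad v (xT k)) * w k.
Proof. exact: dot_field_vec. Qed.

Lemma W_lower (u v : V) : S u -> S v ->
  mu / 2 * dot (E v) (E v) <= W (u + v) - W u + dot (B u) (E v).
Proof.
move=> Su Sv; rewrite total_coenergy_expand// normE mulr_sumr.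
apply: ler_sum => k _; rewrite mulrA ler_wpM2r//.
apply: le_trans (coenergy_lower sigma_gt0 (chi_ge0 k) (UxT k) (U_reg k) _ _).
by rewrite sub_sub_id dotNl dotNr opprK.
Qed.

Lemma W_upper (u v : V) : S u -> S v ->
  W (u + v) - W u + dot (B u) (E v) <= L / 2 * dot (E v) (E v).
Proof.
move=> Su Sv; rewrite total_coenergy_expand// normE mulr_sumr.
apply: ler_sum => k _; rewrite mulrA ler_wpM2r//.
apply: (le_trans (coenergy_upper sigma_gt0 (chi_ge0 k) (UxT k) (U_reg k) _ _)).
by rewrite sub_sub_id dotNl dotNr opprK.
Qed.

Lemma K_coercive (u : V) x : mu * dot x x <= dot (x *m K u) x.
Proof.
rewrite mulmx_block -{1 2 4}[x]vec_mxK /block_apply !dot_mxvec mulr_sumr.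
apply: ler_sum => k _; rewrite rowK.
exact: (newton_coercive sigma_gt0 (chi_ge0 k) (UxT k) (U_reg k)).
Qed.

Let L_gt0 : 0 < L.
Proof. by rewrite addr_gt0// divr_gt0. Qed.

Let mu_le_L : mu <= L.
Proof. by rewrite lerDl divr_ge0// ltW. Qed.

Lemma K_bounded (u : V) x : enorm (x *m K u) <= L * enorm x.
Proof.
apply: le_enorm_of_sqr; first by rewrite mulr_ge0 ?enorm_ge0// ltW.
rewrite exprMn enorm_sqr mulmx_block -{3 4}[x]vec_mxK /block_apply !dot_mxvec mulr_sumr.
apply: ler_sum => k _; rewrite rowK -!enorm_sqr -exprMn.
rewrite ler_pXn2r ?nnegrE ?mulr_ge0 ?enorm_ge0 ?(ltW L_gt0)//.
exact: (newton_bounded sigma_gt0 mu0_gt0 (chi_ge0 k) (UxT k) (U_reg k)).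
Qed.

Let cell_norm (v : V) k : Num.sqrt (w k) * enorm (grad v (xT k)) <= enorm (E v).
Proof.
have -> : Num.sqrt (w k) * enorm (grad v (xT k)) = enorm (Num.sqrt (w k) *: grad v (xT k)).
  by rewrite enormZ ger0_norm// sqrtr_ge0.
apply: le_enorm_of_sqr; first exact: enorm_ge0.
rewrite enorm_sqr normE (bigD1 k)//= dotZl dotZr mulrA -expr2 sqr_sqrtr// mulrC lerDl.
by apply: sumr_ge0 => j _; rewrite mulr_ge0 ?dot_ge0.
Qed.

(** The global error controls the gradient on a cell only up to the square root of its weight, so
    the radius depends on the mesh. Cells of weight 0 escape this control, but contribute nothing to
    the sums. *)
Lemma local_uniform (s : V) (P : 'I_N -> V -> Prop) :
  (forall k, exists2 delta : R, 0 < delta &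
     forall u, S u -> enorm (grad (u - s) (xT k)) < delta -> P k u) ->
  exists2 delta : R, 0 < delta & forall u, S u -> enorm (E (u - s)) < delta ->
    forall k, w k != 0 -> P k u.
Proof.
move=> PH; have /choice[dl dlP] k : exists delta : R, 0 < delta /\
    forall u, S u -> enorm (grad (u - s) (xT k)) < delta -> P k u.
  by have [delta] := PH k; exists delta.
have dl0 k : 0 < (if w k == 0 then 1 else Num.sqrt (w k) * dl k).
  have [//|w0] := eqVneq (w k) 0; rewrite mulr_gt0 ?(dlP k).1//.
  by rewrite sqrtr_gt0 lt_def w0 w_ge0.
have [e e0 He] := common_radius dl0; exists e => // u Su ue k wk.
apply: (dlP k).2 => //; have sw : 0 < Num.sqrt (w k) by rewrite sqrtr_gt0 lt_def wk w_ge0.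
rewrite -(ltr_pM2l sw) (le_lt_trans (cell_norm _ _))// (lt_le_trans ue)//.
by have := He k; rewrite (negbTE wk).
Qed.

Let field_sub (u s : V) k : S u -> S s ->
  magnetic_field M u (xT k) - magnetic_field M s (xT k) = - grad (u - s) (xT k).
Proof.
move=> Su Ss; rewrite /magnetic_field -(scaleN1r s) (grad_Vh_lin Th_conf (-1) k Su Ss) scaleN1r.
by apply/rowP => i; rewrite !mxE; ring.
Qed.

Let neg_sub (a x y : 'rV[R]_d) : - a - (x - y) = - (a - (y - x)).
Proof. by apply/rowP => i; rewrite !mxE; ring. Qed.

Lemma total_semismooth (s : V) (eta : R) : S s -> 0 < eta ->
  exists2 delta : R, 0 < delta & forall u, S u -> enorm (E (u - s)) < delta ->
    enorm (E (u - s) *m K u - (B s - B u)) <= eta * enorm (E (u - s)).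
Proof.
move=> Ss eta0; pose Hf (u : V) k := magnetic_field M u (xT k).
pose res u k := grad (u - s) (xT k) *m (newton_matrix M (xT k) (Hf u k))^T -
  (induction M (xT k) (Hf s k) - induction M (xT k) (Hf u k)).
have [|delta d0 Hd] := @local_uniform s (fun k u =>
    enorm (res u k) <= eta * enorm (grad (u - s) (xT k))).
  move=> k; have [delta d0 Hd] := induction_semismooth sigma_gt0 (chi_ge0 k) (UxT k)
    (U_reg k) (Hf s k) eta0.
  exists delta => // u Su; have := Hd (Hf u k); rewrite (field_sub k Su Ss) !enormN => + h.
  by move=> /(_ h); rewrite mulNmx neg_sub enormN.
exists delta => // u Su ud; have {}Hd := Hd _ Su ud.
apply: le_enorm_of_sqr; first by rewrite mulr_ge0 ?enorm_ge0// ltW.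
have -> : E (u - s) *m K u - (B s - B u) = mxvec (\matrix_k (Num.sqrt (w k) *: res u k)).
  by rewrite mulmx_newton_vec /B /induction_vec !field_vec_sub.
rewrite exprMn enorm_sqr normE mulr_sumr dot_mxvec; apply: ler_sum => k _.
rewrite rowK dotZl dotZr mulrA -expr2 sqr_sqrtr//.
have [->|w0] := eqVneq (w k) 0; first by rewrite mul0r !mulr0.
rewrite [leRHS]mulrA [leRHS]mulrC ler_wpM2l// -!enorm_sqr -exprMn.
rewrite ler_pXn2r ?nnegrE ?mulr_ge0 ?enorm_ge0 ?(ltW eta0)//.
exact: Hd.
Qed.

Lemma total_trapezoid (s : V) (eta : R) : S s -> 0 < eta ->
  exists2 delta : R, 0 < delta & forall u, S u -> enorm (E (u - s)) < delta ->
    `|W u - W s + 2^-1 * dot (B u + B s) (E (u - s))| <= eta * enorm (E (u - s)) ^+ 2.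
Proof.
move=> Ss eta0; pose Hf (u : V) k := magnetic_field M u (xT k).
pose res u k := coenergy M (xT k) (Hf u k) - coenergy M (xT k) (Hf s k) +
  2^-1 * dot (induction M (xT k) (Hf u k) + induction M (xT k) (Hf s k)) (grad (u - s) (xT k)).
have [|delta d0 Hd] := @local_uniform s (fun k u =>
    `|res u k| <= eta * enorm (grad (u - s) (xT k)) ^+ 2).
  move=> k; have [delta d0 Hd] := coenergy_trapezoid sigma_gt0 (chi_ge0 k) (UxT k)
    (U_reg k) (Hf s k) eta0.
  exists delta => // u Su; have := Hd (Hf u k); rewrite (field_sub k Su Ss) !enormN => + h.
  by move=> /(_ h); rewrite dotNr mulrN opprK.
exists delta => // u Su ud; have {}Hd := Hd _ Su ud.
have -> : W u - W s + 2^-1 * dot (B u + B s) (E (u - s)) = \sum_k res u k * w k.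
  have BE z : dot (B z) (E (u - s)) =
      \sum_k dot (induction M (xT k) (Hf z k)) (grad (u - s) (xT k)) * w k.
    exact: dot_field_vec.
  transitivity (W u - W s + 2^-1 *
      ((\sum_k dot (induction M (xT k) (Hf u k)) (grad (u - s) (xT k)) * w k) +
       (\sum_k dot (induction M (xT k) (Hf s k)) (grad (u - s) (xT k)) * w k))).
    apply: f_equal2; first by [].
    apply: f_equal2; first by [].
    apply: (etrans (dotDl (B u) (B s) (E (u - s)))).
    by apply: f_equal2; exact: BE.
  rewrite /W /total_coenergy /quadrature.
  rewrite -sumrB -big_split mulr_sumr -big_split; apply: eq_bigr => k _ /=.
  by rewrite -/(xT k) -/(w k) -mulrBl -mulrDl mulrA -mulrDl -dotDl.
apply: (le_trans (ler_norm_sum _ _ _)).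
rewrite enorm_sqr normE mulr_sumr; apply: ler_sum => k _.
rewrite normrM (ger0_norm (w_ge0 k)) mulrA.
have [->|w0] := eqVneq (w k) 0; first by rewrite !mulr0.
by rewrite ler_wpM2r// -enorm_sqr; exact: Hd.
Qed.

Lemma hdot_ext (u u' v : 'rV[R]_d -> 'rV[R]_d) :
  (forall k, u (xT k) = u' (xT k)) -> hdot Th u v = hdot Th u' v.
Proof. by move=> uu'; apply: eq_bigr => k _; rewrite uu'. Qed.

Let grad_coenergy_hdot (psi : V) v :
  hdot Th (fun x => grad (coenergy M x) (magnetic_field M psi x)) v =
  hdot Th (fun x => induction M x (magnetic_field M psi x)) v.
Proof.
apply: hdot_ext => k.
exact: (grad_coenergy sigma_gt0 mu0_gt0 (chi_ge0 k) (UxT k) (U_reg k)).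
Qed.

Lemma solution_orthogonal (s : V) : discrete_solution M Th s ->
  forall v, S v -> dot (B s) (E v) = 0.
Proof.
move=> [_ Hs] v Sv; apply: (etrans (dot_field_vec _ _)).
by rewrite -grad_coenergy_hdot; exact: Hs.
Qed.

Let dirn := direction S E B K.

Lemma newton_directionP (u dd : V) : newton_direction M Th u dd <-> dirn u dd.
Proof.
have lhs v : dot (E dd *m K u) (E v) = hdot Th (fun x => grad dd x *m
    (newton_matrix M x (magnetic_field M u x))^T) (grad v).
  apply: (etrans _ (dot_field_vec _ _)).
  by apply: f_equal2; first exact: mulmx_newton_vec.
have rhs v : dot (B u) (E v) =
    hdot Th (fun x => grad (coenergy M x) (magnetic_field M u x)) (grad v).
  by rewrite grad_coenergy_hdot; exact: dot_field_vec.
split=> -[Sd dP]; split=> // v Sv.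
  by apply: (etrans (lhs v)); rewrite (dP _ Sv); exact: esym (rhs v).
by rewrite -(lhs v) -(rhs v); exact: dP.
Qed.

Section fixed_solution.
Variable s : V.
Hypothesis Ss : S s.

Lemma search_directionP (u : V) : S u -> dirn u (search_direction M Th u).
Proof.
move=> Su; apply/newton_directionP.
have [dd ddP] := direction_exists B S_lin E_lin mu0_gt0
  (fun u x _ => K_coercive u x) Ss Su.
by apply: (@getPex _ (newton_direction M Th u)); exists dd; exact/newton_directionP.
Qed.

Let phi (u : V) := merit M Th u (search_direction M Th u).

Let S_scale (a : R) (v : V) : S v -> S (a *: v).
Proof.
move=> Sv; have -> : a *: v = v + (a - 1) *: v by rewrite scalerBl scale1r addrC subrK.
exact: S_lin.
Qed.

Let E_scale (a : R) (v : V) : S v -> E (a *: v) = a *: E v.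
Proof.
move=> Sv; have -> : a *: v = v + (a - 1) *: v by rewrite scalerBl scale1r addrC subrK.
by rewrite (E_lin (a - 1) Sv Sv) scalerBl scale1r addrC subrK.
Qed.

Let merit0 (u : V) : phi u 0 = W u.
Proof. by rewrite /phi /merit scale0r addr0. Qed.

Lemma merit_slope (u : V) : S u ->
  derive1 (phi u) 0 = - dot (B u) (E (search_direction M Th u)).
Proof.
move=> Su; have [Sd _] := search_directionP Su; set dd := search_direction M Th u in Sd *.
rewrite derive1E; apply: (derive_of_quadratic_bound (C := L / 2 * dot (E dd) (E dd))) => h.
rewrite merit0 [h *: 1]mulr1 addr0 mulrN opprK.
have Sh := S_scale h Sd.
have := W_upper Su Sh; have := W_lower Su Sh; rewrite (E_scale h Sd).
rewrite !(dotZl, dotZr) => lo up.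
rewrite ger0_norm.
  have -> : L / 2 * dot (E dd) (E dd) * h ^+ 2 = L / 2 * (h * (h * dot (E dd) (E dd))).
    by move: (dot _ _) (L / 2) => a b; ring.
  exact: up.
apply: le_trans lo; rewrite mulr_ge0 ?divr_ge0 ?(ltW mu0_gt0)// mulrA -expr2.
by rewrite mulr_ge0 ?sqr_ge0 ?dot_ge0.
Qed.

(** The relation hides its step length behind an existential quantifier; the second conjunct keeps
    the information about [armijo_step] itself. *)
Lemma newton_step_armijo (u : V) : S u ->
  newton_armijo_step S E W B K mu L sigmaA rho u (newton_step M Th sigmaA rho u) /\
  (admissible E W K sigmaA u (search_direction M Th u) 1 ->
    armijo_step M Th sigmaA rho u = 1).
Proof.
move=> Su; have dP := search_directionP Su.
set dd := search_direction M Th u in dP *.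
have admE t : (phi u t <= phi u 0 + sigmaA * t * derive1 (phi u) 0) =
    (W (u + t *: dd) <= W u - sigmaA * t * dot (E dd *m K u) (E dd)).
  rewrite merit0 (merit_slope Su) mulrN -/dd; congr (_ <= _ - _ * _).
  by have [Sd dPd] := dP; exact: esym (dPd _ Sd).
have small t : 0 <= t <= full_step mu L sigmaA ->
    phi u t <= phi u 0 + sigmaA * t * derive1 (phi u) 0.
  rewrite admE; exact: (small_step_admissible S_lin E_lin mu0_gt0 mu_le_L sigmaA_range
    W_upper (fun u x _ => K_coercive u x) Ss Su dP).
have [adm range one] := armijo_sup rho_range
  (full_step_gt0 mu0_gt0 mu_le_L sigmaA_range) small.
split; last by rewrite /admissible -admE; exact: one.
exists dd, (armijo_step M Th sigmaA rho u); split => //.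
  by rewrite /admissible -admE.
by rewrite /admissible -admE; exact: one.
Qed.

End fixed_solution.

Lemma potential_normE (v : V) : potential_norm Th v = enorm (E v).
Proof. by congr Num.sqrt; exact: esym (dot_field_vec _ _). Qed.

Section solution.
Variable s : V.
Hypothesis s_sol : discrete_solution M Th s.

Let Ss : S s. Proof. by have [] := s_sol. Qed.
Let orth := solution_orthogonal s_sol.
Let iterate := newton_iterate M Th sigmaA rho.
Let K_co (u : V) x (_ : S u) := K_coercive u x.
Let K_bd (u : V) x (_ : S u) := K_bounded u x.
Let semi eta (eta0 : 0 < eta) := total_semismooth Ss eta0.
Let trap eta (eta0 : 0 < eta) := total_trapezoid Ss eta0.

Lemma iterate_Vh (psi0 : V) n : S psi0 -> S (iterate psi0 n).
Proof.
move=> S0; elim: n => // n Sn.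
exact: (step_in_space S_lin Sn (newton_step_armijo Ss Sn).1).
Qed.

Let iterate_step (psi0 : V) (S0 : S psi0) n :
  newton_armijo_step S E W B K mu L sigmaA rho (iterate psi0 n) (iterate psi0 n.+1).
Proof. exact: (newton_step_armijo Ss (iterate_Vh n S0)).1. Qed.

Lemma newton_linear_convergence (psi0 : V) n : S psi0 ->
  potential_norm Th (iterate psi0 n - s) <=
  Num.sqrt (L / mu) * Num.sqrt (1 - decay mu L sigmaA rho) ^+ n *
  potential_norm Th (iterate psi0 0%N - s).
Proof.
move=> S0; rewrite !potential_normE.
exact: (iterate_linear_rate S_lin mu0_gt0 mu_le_L sigmaA_range rho_range W_lower W_upper
  K_co K_bd Ss orth S0 (iterate_step S0)).
Qed.

Lemma newton_local_full_step : exists2 eps : R, 0 < eps &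
  forall psi0 : V, S psi0 -> forall n, potential_norm Th (iterate psi0 n - s) < eps ->
  armijo_step M Th sigmaA rho (iterate psi0 n) = 1.
Proof.
have [eps eps0 H] := newton_full_step S_lin E_lin mu0_gt0 mu_le_L sigmaA_range W_upper
  K_co K_bd Ss orth semi trap.
exists eps => // psi0 S0 n; rewrite potential_normE => close.
have Sn := iterate_Vh n S0; apply: (newton_step_armijo Ss Sn).2.
exact: (H _ _ Sn (search_directionP Ss Sn) close).
Qed.

Lemma newton_superlinear (psi0 : V) : S psi0 ->
  (fun n => potential_norm Th (iterate psi0 n.+1 - s)) =o_\oo
  (fun n => potential_norm Th (iterate psi0 n - s)).
Proof.
move=> S0; apply/eqoP => e e0.
have := iterate_superlinear S_lin E_lin mu0_gt0 mu_le_L sigmaA_range rho_range W_lower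
  W_upper K_co K_bd Ss orth S0 (iterate_step S0) semi trap e0.
have pn m : `|potential_norm Th (iterate psi0 m - s)| = enorm (E (iterate psi0 m - s)).
  by rewrite potential_normE ger0_norm// enorm_ge0.
by apply: filterS => n le_n; rewrite (pn n.+1) (pn n).
Qed.

End solution.

End discrete_problem.

Theorem theorem19 (R : realType) (d : nat) (M : model R d)
    (js : 'rV[R]_d -> 'rV[R]_('C(d, 2))) (sigma sigmaA rho : R)
    (d23 : d = 2%N \/ d = 3%N)
    (Omega_lip : bounded_lipschitz_domain (Omega M))
    (Omega_ball : homeomorphic_to_ball (Omega M))
    (mu0_gt0 : 0 < mu0 M)
    (chi_ge0 : {ae lebesgue_row R d, forall x, Omega M x -> 0 <= chi M x})
    (chi_Linfty : Linfty (Omega M) (chi M))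
    (U_meas : measurable_fun (Omega M `*` [set: 'rV[R]_d])
                (fun p => U M p.1 p.2 : \bar R))
    (U_gtNy : forall x J, Omega M x -> (-oo < U M x J)%E)
    (sigma_gt0 : 0 < sigma)
    (U_reg : {ae lebesgue_row R d, forall x, Omega M x ->
                regular_energy sigma (U M x)})
    (Hs_Hcurl : Hcurl (Omega M) (Hs M))
    (js_curl : weak_curl (Omega M) (Hs M) js)
    (sigmaA_range : 0 < sigmaA < 1 / 2)
    (rho_range : 0 < rho < 1) :
  exists C q : R, [/\ 0 <= C, 0 <= q < 1 &
  forall Th : mesh R d,
    conforming_partition (Omega M) Th ->
    piecewise_continuous Th (chi M) ->
    (forall J, piecewise_continuous Th (fun x => U M x J)) ->
    piecewise_continuous Th (Hs M) ->
    (forall k, regular_energy sigma (U M (barycenter (cell Th k)))) ->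
  forall psi : 'rV[R]_d -> R,
    discrete_solution M Th psi ->
  let iterate := newton_iterate M Th sigmaA rho in
  let err psi0 n := potential_norm Th (iterate psi0 n - psi) in
  [/\ forall psi0, Vh (Omega M) Th psi0 -> forall n, (1 <= n)%N ->
        err psi0 n <= C * q ^+ n * err psi0 0%N,
      exists2 eps : R, 0 < eps &
        forall psi0, Vh (Omega M) Th psi0 -> forall n, err psi0 n < eps ->
          armijo_step M Th sigmaA rho (iterate psi0 n) = 1 &
      forall psi0, Vh (Omega M) Th psi0 ->
        (fun n => err psi0 n.+1) =o_\oo err psi0]].
Proof.
case/andP: (sigmaA_range) => sA0 sA1.
set L := lipschitz_constant M sigma.
have muL : mu0 M <= L by rewrite lerDl divr_ge0// ltW.
have /andP[k0 k1] := decay_range mu0_gt0 muL sigmaA_range rho_range.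
set kappa := decay _ _ _ _ in k0 k1.
(* Both constants are fixed before the mesh is introduced, from mu0, sigma, sigmaA and rho alone. *)
exists (Num.sqrt (L / mu0 M)), (Num.sqrt (1 - kappa)); split.
- exact: sqrtr_ge0.
- by rewrite sqrtr_ge0 -[ltRHS]sqrtr1 ltr_sqrt ?ltr01// gtrBl.
move=> Th conf pw_chi _ _ reg psi sol iterate err.
have [_ oO _ bO _] := Omega_lip.
have chi0 k := chi_ge0_mesh_point conf k chi_ge0 pw_chi.
split.
- move=> psi0 S0 n _.
  exact: (newton_linear_convergence sigma_gt0 mu0_gt0 oO bO conf U_gtNy sigmaA_range
    rho_range chi0 reg sol n S0).
- exact: (newton_local_full_step sigma_gt0 mu0_gt0 oO bO conf U_gtNy sigmaA_range
    rho_range chi0 reg sol).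
- move=> psi0 S0.
  exact: (newton_superlinear sigma_gt0 mu0_gt0 oO bO conf U_gtNy sigmaA_range
    rho_range chi0 reg sol S0).
Qed.
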